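(* Let $n\ge 1$ and let $u\in\mathbb S^{n-1}$ be fixed. For $\varphi\in\mathcal K_1(\mathbb R^n)$ and $g\in\mathcal K_1(\mathbb R)$ put $$DS_{g,u}\varphi(x,z)=\int_{\mathbb R^n}\varphi(t)\,\overline{g(u\cdot t-x)}\,e^{-2\pi i t\cdot z}\,dt,\qquad (x,z)\in\mathbb R\times\mathbb C^n.$$ Then the sesquilinear mapping $$DS:\ \mathcal K_1(\mathbb R^n)\times\mathcal K_1(\mathbb R)\to \mathcal K_1(\mathbb R)\widehat\otimes\,\mathcal U(\mathbb C^n),\qquad (\varphi,g)\mapsto DS_{g,u}\varphi,$$ is continuous.
   Context: $\mathbb S^{n-1}$ is the unit sphere of $\mathbb R^n$. $\mathcal K_1(\mathbb R^n)$ is the space of $\varphi\in C^\infty(\mathbb R^n)$ for which all norms $\rho_k(\varphi)=\sup_{t\in\mathbb R^n,\,|\alpha|\le k}e^{k|t|}|\varphi^{(\alpha)}(t)|$, $k\in\mathbb N_0$, are finite, topologized by these norms. $\mathcal U(\mathbb C^n)$ is the space of entire functions $\varphi$ on $\mathbb C^n$ such that $\theta_k(\varphi)=\sup_{z\in\Pi_k}(1+|z|^2)^{k/2}|\varphi(z)|<\infty$ for all $k\in\mathbb N_0$, where $\Pi_k=\mathbb R^n+i[-k,k]^n$, topologized by these norms. $\mathcal K_1(\mathbb R)\widehat\otimes\,\mathcal U(\mathbb C^n)$ is the completion of the tensor product in the $\pi$-topology (equivalently the $\varepsilon$-topology); it consists of functions $\Phi(x,z)$, smooth in $x\in\mathbb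 R$ and entire in $z\in\mathbb C^n$, and its topology is given by the norms $$\rho^l_k(\Phi)=\sup_{(x,z)\in\mathbb R\times\Pi_k}e^{k|x|}(1+|z|^2)^{k/2}\left|\frac{\partial^l}{\partial x^l}\Phi(x,z)\right|,\qquad k,l\in\mathbb N_0.$$ For $t\in\mathbb R^n$, $z=\xi+i\eta\in\mathbb C^n$, $t\cdot z=t\cdot\xi+i\,t\cdot\eta$. *)

(* Defs.v *)
From HB Require Import structures.
From mathcomp Require Import all_boot all_order all_algebra complex.
From mathcomp Require Import all_classical all_reals all_analysis.

Set Implicit Arguments.
Unset Strict Implicit.
Unset Printing Implicit Defensive.

Import Order.TTheory GRing.Theory Num.Theory.
Import numFieldNormedType.Exports.

Local Open Scope classical_set_scope.
Local Open Scope ring_scope.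
Local Open Scope complex_scope.

Notation normc := Normc.normc.

Definition seminorm_nbhs {R : realType} {I : eqType} {V : zmodType}
    (p : I -> V -> \bar R) (x : V) : set_system V :=
  [set A | exists (s : seq I) (e : R), 0 < e /\
     [set y | forall i, i \in s -> (p i (y - x)%R < e%:E)%E] `<=` A].

Section seminorm_nbhs.
Context {R : realType} {I : eqType} {V : zmodType} (p : I -> V -> \bar R).
Hypothesis p0 : forall i, (p i 0%R <= 0)%E.
Hypothesis pD : forall i x y, (p i (x + y)%R <= p i x + p i y)%E.

Lemma seminorm_nbhs_singleton x (A : set V) : seminorm_nbhs p x A -> A x.
Proof.
move=> [s [e [e0 sA]]]; apply: sA => i _ /=.
by rewrite subrr (le_lt_trans (p0 i))// lte_fin.
Qed.

Lemma seminorm_nbhs_filter x : ProperFilter (seminorm_nbhs p x).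
Proof.
split.
  by move=> /seminorm_nbhs_singleton.
split.
- by exists [::], 1; split.
- move=> A B [s [e [e0 sA]]] [s' [e' [e'0 sB]]].
  exists (s ++ s'), (Num.min e e'); split; first by rewrite lt_min e0.
  move=> y yp; split.
  + apply: sA => i si; apply: lt_le_trans (yp i _) _.
      by rewrite mem_cat si.
    by rewrite lee_fin ge_min lexx.
  + apply: sB => i si; apply: lt_le_trans (yp i _) _.
      by rewrite mem_cat si orbT.
    by rewrite lee_fin ge_min lexx orbT.
- move=> A B AB [s [e [e0 sA]]].
  by exists s, e; split => //; apply: subset_trans AB.
Qed.

Lemma seminorm_nbhs_nbhs x (A : set V) :
  seminorm_nbhs p x A -> seminorm_nbhs p x ((seminorm_nbhs p)^~ A).
Proof.
move=> [s [e [e0 sA]]]; exists s, (e / 2); split; first by rewrite divr_gt0.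
move=> y yx; exists s, (e / 2); split; first by rewrite divr_gt0.
move=> z zy; apply: sA => i si /=.
have -> : z - x = (z - y) + (y - x) by rewrite addrA subrK.
apply: le_lt_trans (pD i _ _) _.
by rewrite [e]splitr EFinD lteD// ?zy ?yx.
Qed.

End seminorm_nbhs.

Section fsup.
Context {R : realType} {T : Type}.
Implicit Types (D : set T) (f : T -> R).

Definition fsup D f : \bar R := ereal_sup [set (f t)%:E | t in D].

Lemma fsup_lty D f :
  (fsup D f < +oo)%E <-> exists M, forall t, D t -> f t <= M.
Proof.
split=> [|[M fM]]; last first.
  apply: (@le_lt_trans _ _ M%:E); last exact: ltry.
  by apply: ge_ereal_sup => _ [t Dt <-]; rewrite lee_fin fM.
have ub t : D t -> ((f t)%:E <= fsup D f)%E.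
  by move=> Dt; apply: ereal_sup_ubound; exists t.
case: (fsup D f) ub => [r|//|] ub _.
  by exists r => t Dt; rewrite -lee_fin ub.
by exists 0 => t /ub; rewrite leeNy_eq.
Qed.

Lemma fsupD D f g h : (forall t, D t -> h t <= f t + g t) ->
  (fsup D h <= fsup D f + fsup D g)%E.
Proof.
move=> hfg; apply: ge_ereal_sup => _ [t Dt <-].
apply: (@le_trans _ _ ((f t)%:E + (g t)%:E)%E).
  by rewrite -EFinD lee_fin hfg.
by apply: leeD; apply: ereal_sup_ubound; exists t.
Qed.

Lemma fsup_le0 D f : (forall t, D t -> f t <= 0) -> (fsup D f <= 0)%E.
Proof. by move=> f0; apply: ge_ereal_sup => _ [t /f0 ft <-]; rewrite lee_fin. Qed.

End fsup.

Section vectors.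
Context {R : realType} {n : nat}.

(* The library norm on row vectors is the sup norm, not the Euclidean one. *)
Definition enorm (t : 'rV[R]_n) : R := Num.sqrt (\sum_i t ord0 i ^+ 2).

Definition cenorm (z : 'rV[R[i]]_n) : R :=
  Num.sqrt (\sum_i normc (z ord0 i) ^+ 2).

Definition dot (t s : 'rV[R]_n) : R := \sum_i t ord0 i * s ord0 i.

Definition cdot (t : 'rV[R]_n) (z : 'rV[R[i]]_n) : R[i] :=
  \sum_i (t ord0 i)%:C * z ord0 i.

Definition tube (k : nat) : set 'rV[R[i]]_n :=
  [set z | forall i, `|complex.Im (z ord0 i)| <= k%:R].

End vectors.

Definition cexp {R : realType} (w : R[i]) : R[i] :=
  (expR (complex.Re w))%:C * (cos (complex.Im w) +i* sin (complex.Im w)).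

Section partial_derivatives.
Context {R : realType} {n : nat}.

Definition pderivs (s : seq 'I_n) (f : 'rV[R]_n -> R) : 'rV[R]_n -> R :=
  foldr (fun i (h : 'rV[R]_n -> R) t => 'D_(delta_mx ord0 i) h t) f s.

Record smooth (f : 'rV[R]_n -> R) : Prop := Smooth {
  smooth_continuous : forall s, continuous (pderivs s f);
  smooth_derivable : forall s i t,
    derivable (pderivs s f) t (delta_mx ord0 i) }.
#[global] Arguments smooth_continuous {f} _ s x.
#[global] Arguments smooth_derivable {f} _ s i t.

Definition csmooth (f : 'rV[R]_n -> R[i]) : Prop :=
  smooth (fun t => complex.Re (f t)) /\ smooth (fun t => complex.Im (f t)).

(* d^alpha = d_0^(alpha 0) ... d_(n-1)^(alpha (n-1)) *)
Definition multi_seq (alpha : 'I_n -> nat) : seq 'I_n :=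
  flatten [seq nseq (alpha i) i | i <- enum 'I_n].

Definition cpderiv (alpha : 'I_n -> nat) (f : 'rV[R]_n -> R[i])
    (t : 'rV[R]_n) : R[i] :=
  pderivs (multi_seq alpha) (fun t => complex.Re (f t)) t +i*
  pderivs (multi_seq alpha) (fun t => complex.Im (f t)) t.

Lemma pderivsZD (a b : R) (f g : 'rV[R]_n -> R) s : smooth f -> smooth g ->
  pderivs s (fun t => a * f t + b * g t) =
  (fun t => a * pderivs s f t + b * pderivs s g t).
Proof.
move=> sf sg; elim: s => [//|i s /= ->]; apply/funext => t.
have df := smooth_derivable sf s i t; have dg := smooth_derivable sg s i t.
have -> : (fun t => a * pderivs s f t + b * pderivs s g t) =
          a *: pderivs s f + b *: pderivs s g by [].
by rewrite (deriveD (derivableZ df) (derivableZ dg)) (deriveZ _ df) (deriveZ _ dg).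
Qed.

Lemma smoothZD (a b : R) (f g : 'rV[R]_n -> R) : smooth f -> smooth g ->
  smooth (fun t => a * f t + b * g t).
Proof.
move=> sf sg; split=> [s|s i] t; rewrite (pderivsZD _ _ _ sf sg).
  have cf := smooth_continuous sf s t.
  have cg := smooth_continuous sg s t.
  exact: (cvgD (cvgM (cvg_cst a) cf) (cvgM (cvg_cst b) cg)).
have df := smooth_derivable sf s i t; have dg := smooth_derivable sg s i t.
exact: (derivableD (derivableZ df) (derivableZ dg)).
Qed.

Lemma pderivs0 s : pderivs s (fun=> 0) = (fun=> 0).
Proof. by elim: s => //= i s ->; apply/funext => t; rewrite derive_cst. Qed.

Lemma smooth0 : smooth (fun=> 0).
Proof.
split=> [s|s i] t; rewrite pderivs0; first exact: (@cst_continuous _ _ (0 : R)).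
exact: derivable_cst.
Qed.

Lemma ReZD (a x y : R[i]) : complex.Re (a * x + y) =
  complex.Re a * complex.Re x + 1 *
    (- complex.Im a * complex.Im x + 1 * complex.Re y).
Proof. by case: a x y => [a b] [c d] [e f] /=; rewrite !mul1r mulNr addrA. Qed.

Lemma ImZD (a x y : R[i]) : complex.Im (a * x + y) =
  complex.Re a * complex.Im x + 1 *
    (complex.Im a * complex.Re x + 1 * complex.Im y).
Proof.
by case: a x y => [a b] [c d] [e f] /=; rewrite !mul1r addrA (mulrC b).
Qed.

Lemma csmooth0 : csmooth 0.
Proof. by split; exact: smooth0. Qed.

Lemma csmoothZD (a : R[i]) f g : csmooth f -> csmooth g ->
  csmooth (a *: f + g).
Proof.
move=> [rf jf] [rg jg]; split.
  rewrite (_ : (fun t => _) = fun t => complex.Re a * complex.Re (f t) + 1 *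
    (- complex.Im a * complex.Im (f t) + 1 * complex.Re (g t))).
    by do 2?apply: smoothZD.
  by apply/funext => t; exact: ReZD.
rewrite (_ : (fun t => _) = fun t => complex.Re a * complex.Im (f t) + 1 *
    (complex.Im a * complex.Re (f t) + 1 * complex.Im (g t))).
  by do 2?apply: smoothZD.
by apply/funext => t; exact: ImZD.
Qed.

Lemma cpderiv0 alpha t : cpderiv alpha 0 t = 0.
Proof. by rewrite /cpderiv/= !pderivs0. Qed.

Lemma cpderivZD alpha (a : R[i]) f g t : csmooth f -> csmooth g ->
  cpderiv alpha (a *: f + g) t = a * cpderiv alpha f t + cpderiv alpha g t.
Proof.
move=> [rf jf] [rg jg]; rewrite [RHS]complexE -complexE.
apply/eqP; rewrite eq_complex ReZD ImZD /=; apply/andP; split; apply/eqP.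
  rewrite (_ : (fun t => _) = fun t => complex.Re a * complex.Re (f t) + 1 *
    (- complex.Im a * complex.Im (f t) + 1 * complex.Re (g t))).
    by rewrite !pderivsZD//; exact: smoothZD.
  by apply/funext => ?; exact: ReZD.
rewrite (_ : (fun t => _) = fun t => complex.Re a * complex.Im (f t) + 1 *
    (complex.Im a * complex.Re (f t) + 1 * complex.Im (g t))).
  by rewrite !pderivsZD//; exact: smoothZD.
by apply/funext => ?; exact: ImZD.
Qed.

End partial_derivatives.

Lemma normc_ge0 {R : realType} (a : R[i]) : 0 <= normc a.
Proof. by case: a => a b; exact: sqrtr_ge0. Qed.

Section K1_seminorm.
Context {R : realType} {n : nat}.

Definition K1_seminorm (k : nat) (f : 'rV[R]_n -> R[i]) : \bar R :=
  fsup [set p : ('I_n -> nat) * 'rV[R]_n | (\sum_i p.1 i <= k)%N]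
       (fun p => expR (k%:R * enorm p.2) * normc (cpderiv p.1 f p.2)).

Definition is_K1 (f : 'rV[R]_n -> R[i]) : Prop :=
  csmooth f /\ forall k, (K1_seminorm k f < +oo)%E.

Definition K1_pred : {pred 'rV[R]_n -> R[i]} := [pred f | `[< is_K1 f >]].

Lemma K1_seminorm0 k : (K1_seminorm k 0%R <= 0)%E.
Proof. by apply: fsup_le0 => p _; rewrite cpderiv0 Normc.normc0 mulr0. Qed.

Lemma K1_seminormD k f g : csmooth f -> csmooth g ->
  (K1_seminorm k (f + g)%R <= K1_seminorm k f + K1_seminorm k g)%E.
Proof.
move=> sf sg; apply: fsupD => p _.
rewrite -[f]scale1r cpderivZD// scale1r mul1r -mulrDr.
by rewrite ler_wpM2l ?expR_ge0 ?le_normcD.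
Qed.

Lemma K1_submod_closed : submod_closed K1_pred.
Proof.
split=> [|a f g /asboolP[sf bf] /asboolP[sg bg]]; apply/asboolP; split.
- exact: csmooth0.
- by move=> k; exact: le_lt_trans (K1_seminorm0 k) _.
- exact: csmoothZD.
- move=> k; have [M fM] := (fsup_lty _ _).1 (bf k).
  have [N gN] := (fsup_lty _ _).1 (bg k).
  apply/fsup_lty; exists (normc a * M + N) => p kp; rewrite cpderivZD//.
  apply: le_trans (lerD (ler_wpM2l (normc_ge0 a) (fM _ kp)) (gN _ kp)).
  rewrite mulrCA -mulrDr ler_wpM2l ?expR_ge0//.
  by apply: le_trans (le_normcD _ _) _; rewrite Normc.normcM.
Qed.

HB.instance Definition _ :=
  GRing.isSubmodClosed.Build _ _ K1_pred K1_submod_closed.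

End K1_seminorm.

Record K1 (R : realType) (n : nat) := MkK1 {
  K1_fun :> 'rV[R]_n -> R[i];
  K1_funP : K1_fun \in K1_pred }.

Section K1_instances.
Context (R : realType) (n : nat).

HB.instance Definition _ := [isSub for @K1_fun R n].
HB.instance Definition _ := [Choice of K1 R n by <:].
HB.instance Definition _ := [SubChoice_isSubLmodule of K1 R n by <:].

Definition K1_norm (k : nat) (f : K1 R n) : \bar R := K1_seminorm k f.

Lemma K1_norm0 k : (K1_norm k 0%R <= 0)%E.
Proof. exact: K1_seminorm0. Qed.

Lemma K1_normD k (f g : K1 R n) :
  (K1_norm k (f + g)%R <= K1_norm k f + K1_norm k g)%E.
Proof.
by apply: K1_seminormD; [have /asboolP[] := K1_funP f|have /asboolP[] := K1_funP g].
Qed.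

HB.instance Definition _ := hasNbhs.Build (K1 R n) (seminorm_nbhs K1_norm).
HB.instance Definition _ := Nbhs_isNbhsTopological.Build (K1 R n)
  (seminorm_nbhs_filter K1_norm0) (seminorm_nbhs_singleton K1_norm0)
  (seminorm_nbhs_nbhs K1_normD).

End K1_instances.

(* The completed tensor product of K_1(R) and U(C^n) is realized as the space
   of functions of (x, z), smooth in x and entire in z, whose norms
   rho^l_k (F) = sup e^(k|x|) (1 + |z|^2)^(k/2) |d^l F / dx^l (x, z)|,
   over x in R and z in the tube R^n + i[-k, k]^n, are all finite. *)

Section smooth1.
Context {R : realType}.
Implicit Types f g : R -> R.

Record smooth1 f : Prop := Smooth1 {
  smooth1_derivable : forall l x, derivable (derive1n l f) x 1 }.
#[global] Arguments smooth1_derivable {f} _ l x.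

Lemma derive1nZD (a b : R) f g l : smooth1 f -> smooth1 g ->
  derive1n l (fun x => a * f x + b * g x) =
  (fun x => a * derive1n l f x + b * derive1n l g x).
Proof.
move=> sf sg; elim: l => [//|l IH]; apply/funext => x.
rewrite !derive1nS IH !derive1E.
have df := smooth1_derivable sf l x; have dg := smooth1_derivable sg l x.
have -> : (fun x => a * derive1n l f x + b * derive1n l g x) =
          a *: derive1n l f + b *: derive1n l g by [].
by rewrite (deriveD (derivableZ df) (derivableZ dg)) (deriveZ _ df) (deriveZ _ dg).
Qed.

Lemma smooth1ZD (a b : R) f g : smooth1 f -> smooth1 g ->
  smooth1 (fun x => a * f x + b * g x).
Proof.
move=> sf sg; split=> l x; rewrite (derive1nZD _ _ _ sf sg).
have df := smooth1_derivable sf l x; have dg := smooth1_derivable sg l x.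
exact: (derivableD (derivableZ df) (derivableZ dg)).
Qed.

Lemma derive1n_0 l : derive1n l (fun=> 0 : R) = (fun=> 0).
Proof.
by elim: l => // l; rewrite derive1nS => ->; apply/funext => x; exact: derive1_cst.
Qed.

Lemma smooth1_0 : smooth1 (fun=> 0).
Proof. by split=> l x; rewrite derive1n_0; exact: derivable_cst. Qed.

End smooth1.

Section KU_seminorm.
Context {R : realType} {n : nat}.
Implicit Types F G : R -> 'rV[R[i]]_n -> R[i].

Definition xsmooth F : Prop := forall z,
  smooth1 (fun x => complex.Re (F x z)) /\ smooth1 (fun x => complex.Im (F x z)).

Definition zentire F : Prop := forall x z,
  differentiable (F x : 'rV[R[i]]_n -> R[i]^o) z.

Definition xderiv (l : nat) F (x : R) (z : 'rV[R[i]]_n) : R[i] :=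
  derive1n l (fun x => complex.Re (F x z)) x +i*
  derive1n l (fun x => complex.Im (F x z)) x.

(* The index kl = (k, l) stands for rho^l_k. *)
Definition KU_seminorm (kl : nat * nat) F : \bar R :=
  fsup [set p : R * 'rV[R[i]]_n | tube kl.1 p.2]
       (fun p => expR (kl.1%:R * `|p.1|) *
                 (1 + cenorm p.2 ^+ 2) `^ (kl.1%:R / 2) *
                 normc (xderiv kl.2 F p.1 p.2)).

Definition is_KU F : Prop :=
  [/\ xsmooth F, zentire F & forall kl, (KU_seminorm kl F < +oo)%E].

Definition KU_pred : {pred R -> 'rV[R[i]]_n -> R[i]} :=
  [pred F | `[< is_KU F >]].

Let ReE (a : R[i]) F G z : (fun x => complex.Re ((a *: F + G) x z)) =
  fun x => complex.Re a * complex.Re (F x z) + 1 *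
    (- complex.Im a * complex.Im (F x z) + 1 * complex.Re (G x z)).
Proof. by apply/funext => x; exact: ReZD. Qed.

Let ImE (a : R[i]) F G z : (fun x => complex.Im ((a *: F + G) x z)) =
  fun x => complex.Re a * complex.Im (F x z) + 1 *
    (complex.Im a * complex.Re (F x z) + 1 * complex.Im (G x z)).
Proof. by apply/funext => x; exact: ImZD. Qed.

Lemma xsmoothZD (a : R[i]) F G : xsmooth F -> xsmooth G -> xsmooth (a *: F + G).
Proof.
move=> sF sG z; have [rF iF] := sF z; have [rG iG] := sG z.
by rewrite ReE ImE; split; do 2?apply: smooth1ZD.
Qed.

Lemma xderiv0 l x z : xderiv l 0 x z = 0.
Proof. by rewrite /xderiv/= !derive1n_0. Qed.

Lemma xderivZD l (a : R[i]) F G x z : xsmooth F -> xsmooth G ->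
  xderiv l (a *: F + G) x z = a * xderiv l F x z + xderiv l G x z.
Proof.
move=> sF sG; have [rF iF] := sF z; have [rG iG] := sG z.
apply/eqP; rewrite eq_complex [complex.Re (_ + _)]ReZD [complex.Im (_ + _)]ImZD.
rewrite /xderiv ReE ImE.
rewrite (derive1nZD _ _ _ rF (smooth1ZD _ _ iF rG)) (derive1nZD _ _ _ iF rG).
rewrite (derive1nZD _ _ _ iF (smooth1ZD _ _ rF iG)) (derive1nZD _ _ _ rF iG).
by rewrite !eqxx.
Qed.

Lemma zentireZD (a : R[i]) F G : zentire F -> zentire G -> zentire (a *: F + G).
Proof.
move=> eF eG x z.
exact: (differentiableD (differentiableZ a (eF x z)) (eG x z)).
Qed.

Lemma KU_seminorm0 kl : (KU_seminorm kl 0%R <= 0)%E.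
Proof. by apply: fsup_le0 => p _; rewrite xderiv0 Normc.normc0 mulr0. Qed.

Lemma KU_seminormD kl F G : xsmooth F -> xsmooth G ->
  (KU_seminorm kl (F + G)%R <= KU_seminorm kl F + KU_seminorm kl G)%E.
Proof.
move=> sF sG; apply: fsupD => p _.
rewrite -[F]scale1r xderivZD// scale1r mul1r -mulrDr.
by rewrite ler_wpM2l ?mulr_ge0 ?expR_ge0 ?powR_ge0 ?le_normcD.
Qed.

Lemma KU_submod_closed : submod_closed KU_pred.
Proof.
split=> [|a F G /asboolP[sF eF bF] /asboolP[sG eG bG]]; apply/asboolP; split.
- by move=> z; split; exact: smooth1_0.
- by move=> x z; exact: differentiable_cst.
- by move=> k; exact: le_lt_trans (KU_seminorm0 k) _.
- exact: xsmoothZD.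
- exact: zentireZD.
- move=> k; have [M fM] := (fsup_lty _ _).1 (bF k).
  have [N gN] := (fsup_lty _ _).1 (bG k).
  apply/fsup_lty; exists (normc a * M + N) => p kp; rewrite xderivZD//.
  apply: le_trans (lerD (ler_wpM2l (normc_ge0 a) (fM _ kp)) (gN _ kp)).
  rewrite mulrCA -mulrDr ler_wpM2l ?mulr_ge0 ?expR_ge0 ?powR_ge0//.
  by apply: le_trans (le_normcD _ _) _; rewrite Normc.normcM.
Qed.

HB.instance Definition _ :=
  GRing.isSubmodClosed.Build _ _ KU_pred KU_submod_closed.

End KU_seminorm.

Record KU (R : realType) (n : nat) := MkKU {
  KU_fun :> R -> 'rV[R[i]]_n -> R[i];
  KU_funP : KU_fun \in KU_pred }.

Section KU_instances.
Context (R : realType) (n : nat).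

HB.instance Definition _ := [isSub for @KU_fun R n].
HB.instance Definition _ := [Choice of KU R n by <:].
HB.instance Definition _ := [SubChoice_isSubLmodule of KU R n by <:].

Definition KU_norm (kl : nat * nat) (F : KU R n) : \bar R := KU_seminorm kl F.

Lemma KU_norm0 kl : (KU_norm kl 0%R <= 0)%E.
Proof. exact: KU_seminorm0. Qed.

Lemma KU_normD kl (F G : KU R n) :
  (KU_norm kl (F + G)%R <= KU_norm kl F + KU_norm kl G)%E.
Proof.
by apply: KU_seminormD; [have /asboolP[] := KU_funP F|have /asboolP[] := KU_funP G].
Qed.

HB.instance Definition _ := hasNbhs.Build (KU R n) (seminorm_nbhs KU_norm).
HB.instance Definition _ := Nbhs_isNbhsTopological.Build (KU R n)
  (seminorm_nbhs_filter KU_norm0) (seminorm_nbhs_singleton KU_norm0)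
  (seminorm_nbhs_nbhs KU_normD).

End KU_instances.

Definition tuple_of_pair {R : realType} {n : nat}
    (p : measurableTypeR R * n.-tuple (measurableTypeR R)) :
  n.+1.-tuple (measurableTypeR R) := [tuple of p.1 :: p.2].

Section lebesgue_step.
Context {R : realType} {n : nat}.
Variable mu : {sigma_finite_measure set (n.-tuple (measurableTypeR R)) -> \bar R}.

Lemma measurable_tuple_of_pair :
  measurable_fun [set: measurableTypeR R * n.-tuple (measurableTypeR R)]
    (@tuple_of_pair R n).
Proof. exact: measurable_cons. Qed.

Definition lebesgue_step :=
  pushforward (@lebesgue_measure R \x mu)%E (@tuple_of_pair R n).

Let pushed : {measure set (n.+1.-tuple (measurableTypeR R)) -> \bar R} :=
  measure_function_pushforward__canonical__measure_function_Measure
    (@lebesgue_measure R \x mu)%E measurable_tuple_of_pair.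

HB.instance Definition _ := isMeasure.Build _ _ _ lebesgue_step
  (measure0 pushed) (measure_ge0 pushed) (@measure_semi_sigma_additive _ _ _ pushed).

Let pair_of_tuple (s : n.+1.-tuple (measurableTypeR R)) :
  measurableTypeR R * n.-tuple (measurableTypeR R) :=
  (tnth s ord0, [tuple of behead s]).

Let measurable_pair_of_tuple : measurable_fun setT pair_of_tuple.
Proof.
apply: measurable_fun_pair; first exact: measurable_tnth.
exact: measurable_behead.
Qed.

Let tuple_of_pairK : cancel (@tuple_of_pair R n) pair_of_tuple.
Proof. by case=> x s; congr pair; exact: val_inj. Qed.

Lemma lebesgue_step_sigma_finite : sigma_finite setT lebesgue_step.
Proof.
have /sigma_finiteP[F [FT ndF Foo]] := sigma_finiteT (@lebesgue_measure R).
have /sigma_finiteP[G [GT ndG Goo]] := sigma_finiteT mu.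
exists (fun k => pair_of_tuple @^-1` (F k `*` G k)).
  rewrite -preimage_bigcup; apply/esym; rewrite -subTset => s _ /=.
  have [i _ Fi] : (\bigcup_k F k) (tnth s ord0) by rewrite -FT.
  have [j _ Gj] : (\bigcup_k G k) [tuple of behead s] by rewrite -GT.
  exists (maxn i j) => //; split => /=.
  - by move: Fi; exact/subsetPset/ndF/leq_maxl.
  - by move: Gj; exact/subsetPset/ndG/leq_maxr.
move=> k; have [mF oF] := Foo k; have [mG oG] := Goo k.
have mFG : measurable (F k `*` G k) by exact: measurableX.
split.
  by rewrite -[X in measurable X]setTI; exact: measurable_pair_of_tuple.
rewrite /lebesgue_step /pushforward -comp_preimage.
rewrite (_ : _ \o _ = id); last by apply/funext => p; exact: tuple_of_pairK.
by rewrite preimage_id product_measure1E// lte_mul_pinfty// ge0_fin_numE.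
Qed.

HB.instance Definition _ :=
  Measure_isSigmaFinite.Build _ _ _ lebesgue_step lebesgue_step_sigma_finite.

End lebesgue_step.

(* Lebesgue measure on R^n, as the n-fold product of the Lebesgue measure on R,
   transported from R * (R * ...) to n-tuples. *)
Fixpoint lebesgue_Rn (R : realType) (n : nat) :
    {sigma_finite_measure set (n.-tuple (measurableTypeR R)) -> \bar R} :=
  match n with
  | 0 => @dirac _ (0.-tuple (measurableTypeR R)) [tuple] R
  | n'.+1 => lebesgue_step (lebesgue_Rn R n')
  end.

Section integral_Rn.
Context {R : realType} {n : nat}.

Definition row_of_tuple (s : n.-tuple (measurableTypeR R)) : 'rV[R]_n :=
  \row_i tnth s i.

Definition integrable_Rn (f : 'rV[R]_n -> R[i]) : Prop :=
  (lebesgue_Rn R n).-integrable setT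
    (fun s => (complex.Re (f (row_of_tuple s)))%:E) /\
  (lebesgue_Rn R n).-integrable setT
    (fun s => (complex.Im (f (row_of_tuple s)))%:E).

Definition integral_Rn (f : 'rV[R]_n -> R[i]) : R[i] :=
  (\int[lebesgue_Rn R n]_s complex.Re (f (row_of_tuple s))) +i*
  (\int[lebesgue_Rn R n]_s complex.Im (f (row_of_tuple s))).

End integral_Rn.

Section DS.
Context {R : realType} {n : nat}.

(* K_1(R) is K_1(R^1), a real number s being identified with const_mx s. *)
Definition DS_integrand (u : 'rV[R]_n) (phi : 'rV[R]_n -> R[i])
    (g : 'rV[R]_1 -> R[i]) (x : R) (z : 'rV[R[i]]_n) (t : 'rV[R]_n) : R[i] :=
  phi t * conjc (g (const_mx (dot u t - x))) *
  cexp (- ((2 * pi)%:C * 'i%C * cdot t z)).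

Definition DS (u : 'rV[R]_n) (phi : 'rV[R]_n -> R[i]) (g : 'rV[R]_1 -> R[i])
    (x : R) (z : 'rV[R[i]]_n) : R[i] :=
  integral_Rn (DS_integrand u phi g x z).

End DS.

(* Main.v *)
From HB Require Import structures.
Require Import Defs.
From mathcomp Require Import all_boot all_order all_algebra complex.
From mathcomp Require Import all_classical all_reals all_analysis.
From mathcomp Require Import measurable_realfun.
From mathcomp Require Import ring lra.

(** The whole theorem rests on one estimate: for every seminorm (k, l) of the
    target there are an order N and a constant C such that the seminorm of the
    transform of [phi] and [g] is at most C times the product of the N-th
    seminorms of [phi] and [g] ([KU_seminorm_DS]). As the transform is
    sesquilinear, the difference of its values at two pairs splits into three
    transforms of differences, and the estimate gives joint continuity.

    For the estimate, start from the pointwise bound on the integrand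
    ([DS_integrand_bound]). The functions [phi] and [g] decay faster than any
    exponential. Writing |x| <= |u.t| + |u.t - x| distributes the weight e^(k|x|)
    between [phi(t)] and [g(u.t - x)], and for z in the tube of width k the Fourier
    kernel grows at most exponentially in t, which [phi] absorbs as well. What is
    left is dominated by the integrable weight exp(- sum |t_i|). This gives
    integrability, the decay in x, and the right to differentiate under the
    integral sign.

    Differentiating in x replaces [g] by minus its derivative ([DS_cderive]), so
    derivatives in x cost derivatives of [g] only. The polynomial weight in z is
    comparable to 1 + |z_j|^k for the coordinate j that is largest in modulus.
    The factor z_j is obtained by integration by parts in t_j ([DS_parts]): the
    integral of a partial derivative of the integrand vanishes
    ([integral_Rn_partial_eq0]), and the derivative of the kernel is
    - 2 pi i z_j times the kernel. Iterating k times in the same direction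
    ([DS_decay]) consumes k derivatives of [phi] and [g] in total.

    Holomorphy in z ([zentire_DS]) follows from the second-order Taylor estimate
    of the exponential ([cexp_bound]) integrated against the exponentially
    decaying integrand: the transform agrees with an affine function of z up to a
    quadratic error.

    Lebesgue measure on R^n is here an iterated product carried by tuples. Hence
    the vanishing of integrals of partial derivatives is proved by induction on
    the dimension with Fubini's theorem ([integral_partial_eq0]), and continuous
    functions are first shown to be measurable for the product sigma-algebra
    ([continuous_measurable_row]). *)

Import Order.TTheory GRing.Theory Num.Theory.
Import numFieldNormedType.Exports.
Local Open Scope classical_set_scope.
Local Open Scope ring_scope.
Set Implicit Arguments.
Unset Strict Implicit.
Unset Printing Implicit Defensive.
Local Open Scope complex_scope.

Notation cRe := complex.Re.
Notation cIm := complex.Im.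

(** * Measurability of continuous functions of a tuple *)

Section measurability.
Context {R : realType} {n : nat}.

Lemma rV_norm_le (x : 'rV[R]_n) (e : R) : 0 <= e ->
  (forall i, `|x ord0 i| <= e) -> `|x| <= e.
Proof.
move=> e0 xe; rewrite [`|x|]mx_normrE; apply: bigmax_le => // -[i j] _ /=.
by rewrite (ord1 i).
Qed.

(** A continuous [f] is the pointwise limit of its values at the points obtained
    by rounding every coordinate down to the grid of mesh [1 / m.+1]; each of
    these approximations is constant on each of countably many measurable boxes
    and thus measurable for the product sigma-algebra. *)
Lemma continuous_measurable_row (f : 'rV[R]_n -> R) : continuous f ->
  measurable_fun setT (fun s => f (row_of_tuple s)).
Proof.
move=> cf.
pose q (m : nat) (s : n.-tuple (measurableTypeR R)) : 'rV[int]_n :=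
  \row_i Num.floor (m.+1%:R * tnth s i).
pose g (m : nat) (v : 'rV[int]_n) : R := f (\row_i ((v ord0 i)%:~R / m.+1%:R)).
apply: (@measurable_fun_cvg _ _ _ _ (fun m s => g m (q m s))) => [m _ A mA|s _].
  rewrite setTI (_ : _ @^-1` A =
    \bigcup_(v : 'rV[int]_n) (if `[< A (g m v) >] then [set s | q m s = v] else set0)).
    apply: countable_bigcupT_measurable; first exact: countableP.
    move=> v; case: asboolP => // _.
    rewrite (_ : [set s | _] = \bigcap_(i in [set: 'I_n])
      ((fun s : n.-tuple (measurableTypeR R) => m.+1%:R * tnth s i) @^-1`
         `[(v ord0 i)%:~R, (v ord0 i + 1)%:~R[)).
      apply: fin_bigcap_measurable => // i _.
      rewrite -[X in measurable X]setTI; apply: measurable_funM => //.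
      exact: measurable_tnth.
    apply/seteqP; split => t /= => [<- i _ /=|tv].
      by rewrite mxE in_itv/= floor_le floorD1_gt.
    apply/rowP => i; rewrite mxE; apply/floor_def.
    by have := tv i I; rewrite /= in_itv.
  apply/seteqP; split => [s As|s [v _]] /=.
    by exists (q m s) => //; case: asboolP.
  by case: asboolP => //= Av ->.
apply: (@cvg_comp _ _ _
  (fun m : nat => \row_i ((q m s ord0 i)%:~R / m.+1%:R) : 'rV[R]_n) f _
  (nbhs (row_of_tuple s))); last exact: cf.
apply/cvgrPdist_le => e e0.
near=> m; apply: rV_norm_le => [|i]; first exact: ltW.
rewrite !mxE.
set y := tnth s i; have m0 : 0 < m.+1%:R :> R by [].
have -> : y - (Num.floor (m.+1%:R * y))%:~R / m.+1%:R =
  (m.+1%:R * y - (Num.floor (m.+1%:R * y))%:~R) / m.+1%:R by field.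
have fl := floor_le (m.+1%:R * y); have fg := floorD1_gt (m.+1%:R * y).
rewrite intrD in fg.
rewrite ger0_norm ?divr_ge0 ?subr_ge0// ler_pdivrMr//.
apply: (@le_trans _ _ 1); first lra.
rewrite mulrC -ler_pdivrMr// div1r; apply: ltW; near: m.
exists (Num.truncn e^-1) => // k /= ek.
by rewrite (lt_le_trans (truncnS_gt _))// ler_nat ltnS.
Unshelve. all: by end_near. Qed.

End measurability.

(** * Integrals over the line *)

Section line_integrals.
Context {R : realType}.
Notation mu := (@lebesgue_measure R).

Lemma continuous_expR_Nabs : continuous (fun x : R => expR (- `|x|)).
Proof.
move=> x; apply: continuous_comp; last exact: continuous_expR.
by apply: continuousN; exact: norm_continuous.
Qed.

Lemma integrable_expR_Nabs :
  mu.-integrable setT (EFin \o (fun x : R => expR (- `|x|))).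
Proof.
have mw : measurable_fun setT (fun x : R => expR (- `|x|)).
  by apply: continuous_measurable_fun; exact: continuous_expR_Nabs.
apply/integrableP; split; first exact/measurable_EFinP.
under eq_integral do rewrite /= ger0_norm ?expR_ge0//.
rewrite (ge0_symfun_integralT _ continuous_expR_Nabs)//; last first.
  by move=> x /=; rewrite normrN.
rewrite -set_itvcy.
under eq_integral => x.
  rewrite inE/= in_itv/= andbT => x0; rewrite ger0_norm//.
  over.
rewrite (@ge0_continuous_FTC2y _ _ (fun x : R => - expR (- x)) 0 0).
- by rewrite -EFinB lte_mul_pinfty// ?ltry.
- by move=> x _; exact: expR_ge0.
- apply: continuous_subspaceT => x.
  by apply: continuous_comp; [exact: opp_continuous|exact: continuous_expR].
- rewrite -oppr0; apply: cvgN; exact: cvgr_expR.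
- by move=> x _; apply: ex_derive.
- apply: cvg_at_right_filter; apply: cvgN.
  by apply: continuous_comp; [exact: opp_continuous|exact: continuous_expR].
- move=> x _; rewrite derive1E; apply: derive_val.
  by apply: is_derive_eq; rewrite mulrN1 opprK.
Qed.

(** The integral of [G = F'] over [[-k, k]] is [F k - F (- k)], which tends to
    0; by dominated convergence it also tends to the integral over the line. *)
Lemma integral_derivative_eq0 (F G : R -> R) (C : R) :
  (forall x : R, is_derive x 1 F (G x)) -> continuous G ->
  (forall x, `|F x| <= C * expR (- `|x|)) ->
  (forall x, `|G x| <= C * expR (- `|x|)) ->
  (\int[mu]_x (G x)%:E = 0)%E.
Proof.
move=> dF cG FC GC.
have mG : measurable_fun setT G by exact: continuous_measurable_fun.
pose I (k : nat) : set R := [set` `[- k.+1%:R, k.+1%:R]].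
have iw : mu.-integrable setT (EFin \o (fun x : R => C * expR (- `|x|))).
  by have := integrableZl measurableT C integrable_expR_Nabs.
have IE k : (\int[mu]_x ((EFin \o G) \_ (I k)) x =
    (F k.+1%:R)%:E - (F (- k.+1%:R))%:E)%E.
  have cF : continuous F.
    move=> x; apply/differentiable_continuous/derivable1_diffP.
    by have [] := dF x.
  rewrite -integral_mkcond; apply: continuous_FTC2.
  - by rewrite -subr_gt0 opprK addr_gt0.
  - exact: continuous_subspaceT.
  - split=> [x _| |]; first by have [] := dF x.
      by apply: cvg_at_right_filter; exact: cF.
    by apply: cvg_at_left_filter; exact: cF.
  - by move=> x _; rewrite derive1E; apply: derive_val.
have mGI k : measurable_fun setT ((EFin \o G) \_ (I k)).
  apply/(measurable_restrictT _ _).1; first exact: measurable_itv.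
  by apply: measurable_funTS; exact/measurable_EFinP.
have GI x : [set: R] x -> (fun k => ((EFin \o G) \_ (I k)) x) @ \oo --> (G x)%:E.
  move=> _; apply: cvg_near_cst; exists (Num.truncn `|x|) => // k /= xk.
  rewrite patchE ifT// inE /I /= in_itv/= -ler_norml.
  by rewrite (le_trans (ltW (truncnS_gt _)))// ler_nat.
have GIC k x : [set: R] x -> (`|((EFin \o G) \_ (I k)) x| <=
    (C * expR (- `|x|))%:E)%E.
  move=> _; rewrite patchE; case: ifP => _; first by rewrite lee_fin.
  by rewrite abse0 lee_fin (le_trans _ (FC x)).
have [||_ _ /cvg_lim <-//] := @dominated_convergence _ _ _ mu setT measurableT
  (fun k => (EFin \o G) \_ (I k)) (EFin \o G) _ mGI ((measurable_EFinP _ _).2 mG)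
  _ iw.
- by apply: aeW => x; exact: GI.
- by apply: aeW => x k; exact: GIC.
apply/cvg_lim => //.
rewrite (_ : [sequence _]_k = EFin \o
  (fun k : nat => F k.+1%:R - F (- k.+1%:R))); last first.
  by apply/funext => k /=; rewrite IE.
apply: cvg_EFin; first exact: nearW.
apply: norm_cvg0.
apply: (@squeeze_cvgr _ _ _ _ (fun=> 0) (fun k : nat => 2 * C * expR (- k.+1%:R))).
- apply: nearW => k; rewrite normr_ge0/= (le_trans (ler_normB _ _))//.
  have := FC k.+1%:R; have := FC (- k.+1%:R); rewrite normrN.
  rewrite (@ger0_norm _ k.+1%:R)// => FN FP.
  by rewrite (le_trans (lerD FP FN))// -mulrA mulr_natl mulr2n.
- exact: cvg_cst.
rewrite -[X in _ --> X](mulr0 (2 * C)); apply: cvgM; first exact: cvg_cst.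
apply: (@cvg_comp _ _ _ (fun k : nat => k.+1%:R) (fun x : R => expR (- x)) _ +oo%R).
  apply/cvgryPge => A; exists (Num.truncn A) => // k /= Ak.
  by rewrite (le_trans (ltW (truncnS_gt _)))// ler_nat.
exact: cvgr_expR.
Qed.

End line_integrals.

(** * Fubini and vanishing integrals of partial derivatives *)

Section tuple_integrals.
Context {R : realType}.
Notation lambda := (@lebesgue_measure R).
Notation tup n := (n.-tuple (measurableTypeR R)).

(** A product of functions of one variable, so that it factors under Fubini and
    dominates [exp (- n |t|)] for the Euclidean norm of [R^n]. *)
Definition exp_weight n (s : tup n) : R := expR (- \sum_i `|tnth s i|).

Lemma exp_weight_cons n (x : R) (v : tup n) :
  exp_weight (tuple_of_pair (x, v)) = expR (- `|x|) * exp_weight v.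
Proof.
rewrite /exp_weight big_ord_recl opprD expRD tnth0.
by congr (_ * expR (- _)); apply: eq_bigr => i _; rewrite tnthS.
Qed.

Lemma measurable_exp_weight n : measurable_fun setT (@exp_weight n).
Proof.
apply: measurableT_comp => //; apply: measurableT_comp => //.
apply: measurable_sum => i; apply: measurableT_comp => //.
exact: measurable_tnth.
Qed.

Section step.
Context {n : nat}.
Variable mu : {sigma_finite_measure set (tup n) -> \bar R}.

(** The recursive definition of Lebesgue measure on [n.+1]-tuples is a
    pushforward of a product measure: Tonelli for that measure. *)
Lemma ge0_integral_step (f : tup n.+1 -> \bar R) : measurable_fun setT f ->
  (forall s, 0 <= f s)%E ->
  (\int[lebesgue_step mu]_s f s =
   \int[lambda]_x \int[mu]_v f (tuple_of_pair (x, v)))%E.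
Proof.
move=> mf f0.
rewrite (ge0_integral_pushforward measurable_tuple_of_pair)//=.
rewrite preimage_setT fubini_tonelli1//.
by apply: measurableT_comp => //; exact: measurable_tuple_of_pair.
Qed.

Lemma integrable_step_prod (f : tup n.+1 -> \bar R) :
  (lebesgue_step mu).-integrable setT f ->
  (lambda \x mu)%E.-integrable setT (f \o @tuple_of_pair R n).
Proof.
move=> /integrableP[mf foo]; apply/integrableP; split.
  by apply: measurableT_comp => //; exact: measurable_tuple_of_pair.
rewrite (ge0_integral_pushforward measurable_tuple_of_pair) in foo => //.
exact: measurableT_comp.
Qed.

Lemma integral_step (f : tup n.+1 -> \bar R) :
  (lebesgue_step mu).-integrable setT f ->
  (\int[lebesgue_step mu]_s f s =
   \int[lambda \x mu]_p f (tuple_of_pair p))%E.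
Proof.
move=> intf.
have mf := measurable_int _ intf.
rewrite (integral_pushforward measurable_tuple_of_pair)//.
exact: integrable_step_prod.
Qed.

End step.

Lemma integrable_exp_weight n :
  (lebesgue_Rn R n).-integrable setT (EFin \o @exp_weight n).
Proof.
elim: n => [|n IH].
  apply/integrableP; split.
    by apply/measurable_EFinP; exact: measurable_exp_weight.
  rewrite integral_dirac//; last first.
    by apply/measurable_EFinP/measurableT_comp => //; exact: measurable_exp_weight.
  by rewrite diracT mul1e ltry.
apply/integrableP; split.
  by apply/measurable_EFinP; exact: measurable_exp_weight.
rewrite ge0_integral_step//; last first.
  by apply/measurable_EFinP/measurableT_comp => //; exact: measurable_exp_weight.
have [mE Eoo] := integrableP _ _ _ (@integrable_expR_Nabs R).
have [mW Woo] := integrableP _ _ _ IH.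
have E x : (\int[lebesgue_Rn R n]_v
      `|(EFin \o @exp_weight n.+1) (tuple_of_pair (x, v))| =
    (expR (- `|x|))%:E * \int[lebesgue_Rn R n]_v `|(EFin \o @exp_weight n) v|)%E.
  rewrite -ge0_integralZl//; last exact: measurableT_comp.
  apply: eq_integral => v _.
  by rewrite /= exp_weight_cons normrM ger0_norm ?expR_ge0.
rewrite (eq_integral _ _ (fun x _ => E x)).
rewrite ge0_integralZr//; last exact: integral_ge0.
rewrite lte_mul_pinfty//; first exact: integral_ge0.
rewrite ge0_fin_numE ?integral_ge0//.
apply: le_lt_trans Eoo; rewrite le_eqVlt; apply/orP; left; apply/eqP.
by apply: eq_integral => x _; rewrite [RHS]/= [in RHS]ger0_norm ?expR_ge0.
Qed.

Lemma integrable_exp_weight_le n (F : tup n -> R) (C : R) :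
  measurable_fun setT F -> (forall s, `|F s| <= C * exp_weight s) ->
  (lebesgue_Rn R n).-integrable setT (EFin \o F).
Proof.
move=> mF FC.
apply: (@le_integrable _ _ _ _ _ _ _ (fun s => (C%:E * (exp_weight s)%:E)%E)) => //.
- exact/measurable_EFinP.
- by move=> s _; rewrite /= lee_fin (le_trans (FC s))// ler_norm.
by have := integrableZl measurableT C (@integrable_exp_weight n).
Qed.

Definition set_tnth n (j : 'I_n) (y : R) (s : tup n) : tup n :=
  [tuple if i == j then y else tnth s i | i < n].

Lemma set_tnth0 n y x (v : tup n) :
  set_tnth ord0 y (tuple_of_pair (x, v)) = tuple_of_pair (y, v).
Proof.
apply: eq_from_tnth => i; rewrite tnth_mktuple.
have [->|] := eqVneq i ord0; first by rewrite tnth0.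
by case: (unliftP ord0 i) => [k ->|->]; rewrite ?eqxx// !tnthS.
Qed.

Lemma set_tnth_lift n (j : 'I_n) y x (v : tup n) :
  set_tnth (lift ord0 j) y (tuple_of_pair (x, v)) =
  tuple_of_pair (x, set_tnth j y v).
Proof.
apply: eq_from_tnth => i; rewrite tnth_mktuple.
case: (unliftP ord0 i) => [k ->|->]; last by rewrite !tnth0.
by rewrite !tnthS tnth_mktuple (inj_eq lift_inj).
Qed.

(** Induction on the dimension. For the first coordinate the inner integral of
    Fubini is an integral over the line and vanishes; for another one it is an
    integral of a partial derivative in one dimension less. The exponential
    bound is inherited by the slices, which also makes Fubini applicable. *)
Lemma integral_partial_eq0 n (j : 'I_n) (F G : tup n -> R) (C : R) :
  measurable_fun setT F -> measurable_fun setT G ->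
  (forall s (y : R), is_derive y 1 (fun y => F (set_tnth j y s)) (G (set_tnth j y s))) ->
  (forall s, continuous (fun y : R => G (set_tnth j y s))) ->
  (forall s, `|F s| <= C * exp_weight s) ->
  (forall s, `|G s| <= C * exp_weight s) ->
  (\int[lebesgue_Rn R n]_s (G s)%:E = 0)%E.
Proof.
elim: n j F G C => [[]//|n IH] j F G C mF mG dF cG FC GC.
have iG := integrable_exp_weight_le mG GC.
rewrite /= integral_step//.
have mcons x : measurable_fun setT (fun v => @tuple_of_pair R n (x, v)).
  apply: (measurableT_comp measurable_tuple_of_pair); exact: pair1_measurable.
have ipG := integrable_step_prod iG.
case: (unliftP ord0 j) => [k jk|j0].
- rewrite -integral12_prod_meas1//; apply: integral0_eq => x _.
  apply: (IH k (fun v => F (tuple_of_pair (x, v)))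
     (fun v => G (tuple_of_pair (x, v))) (C * expR (- `|x|))).
  + exact: measurableT_comp.
  + exact: measurableT_comp.
  + move=> s y; have := dF (tuple_of_pair (x, s)) y.
    by rewrite jk set_tnth_lift; under eq_fun do rewrite set_tnth_lift.
  + move=> s; have := cG (tuple_of_pair (x, s)).
    by rewrite jk; under eq_fun do rewrite set_tnth_lift.
  + by move=> s; rewrite -mulrA -exp_weight_cons.
  + by move=> s; rewrite -mulrA -exp_weight_cons.
- rewrite -integral21_prod_meas1//; apply: integral0_eq => v _.
  apply: (@integral_derivative_eq0 _ (fun x => F (tuple_of_pair (x, v))) _
    (C * exp_weight v)).
  + move=> y; have := dF (tuple_of_pair (0, v)) y.
    by rewrite j0 set_tnth0; under eq_fun do rewrite set_tnth0.
  + have := cG (tuple_of_pair (0, v)).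
    by rewrite j0; under eq_fun do rewrite set_tnth0.
  + by move=> s; rewrite mulrAC -mulrA -exp_weight_cons.
  + by move=> s; rewrite mulrAC -mulrA -exp_weight_cons.
Qed.

End tuple_integrals.

(** * Complex-valued calculus in a real variable *)

Section real_bounds.
Context {R : realType}.

(** Common form of the elementary estimates of [sin] and [cos] at 0 below. *)
Lemma mvt_bound (f df : R -> R) (K y : R) : f 0 = 0 ->
  (forall x : R, is_derive x 1 f (df x)) ->
  (forall t, `|t| <= `|y| -> `|df t| <= K) -> `|f y| <= K * `|y|.
Proof.
move=> f0 dF dfK.
have cf : continuous f.
  by move=> x; apply/differentiable_continuous/derivable1_diffP; have [] := dF x.
have [y0|y0|->] := ltgtP y 0; last by rewrite f0 !normr0 mulr0.
- have [|c] := @MVT _ f df y 0 y0.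
    exact: continuous_subspaceT.
  rewrite in_itv/= => /andP[yc c0]; rewrite f0 !sub0r => /(congr1 Num.norm).
  rewrite normrN normrM normrN => ->; rewrite ler_wpM2r// dfK//.
  by rewrite !ltr0_norm// lerN2 ltW.
- have [|c] := @MVT _ f df 0 y y0.
    exact: continuous_subspaceT.
  rewrite in_itv/= => /andP[yc c0]; rewrite f0 !subr0 => ->.
  by rewrite normrM ler_wpM2r// dfK// !gtr0_norm// ltW.
Qed.

Lemma sin_bound (y : R) : `|sin y| <= `|y|.
Proof.
rewrite -[leRHS]mul1r; apply: (@mvt_bound _ cos); first exact: sin0.
by move=> t _; rewrite ler_norml cos_geN1 cos_le1.
Qed.

Lemma cosB1_bound (y : R) : `|cos y - 1| <= `|y| ^+ 2.
Proof.
apply: (@mvt_bound (fun y => cos y - 1) (fun y => - sin y)).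
- by rewrite cos0 subrr.
- by move=> x; apply: is_derive_eq; rewrite oppr0 addr0.
- by move=> t ty; rewrite normrN (le_trans (sin_bound t)).
Qed.

Lemma sinB_bound (y : R) : `|sin y - y| <= `|y| ^+ 2.
Proof.
apply: (@mvt_bound (fun y => sin y - y) (fun y => cos y - 1)).
- by rewrite sin0 subrr.
- move=> t ty; apply: le_trans ty.
  rewrite -[leRHS]mul1r; apply: (@mvt_bound (fun y => cos y - 1) (fun y => - sin y)).
  + by rewrite cos0 subrr.
  + by move=> x; apply: is_derive_eq; rewrite oppr0 addr0.
  + by move=> s _; rewrite normrN ler_norml sin_geN1 sin_le1.
Qed.

Lemma expRB1_le (x : R) : expR x - 1 <= x * expR x.
Proof.
have : expR x * (1 + - x) <= expR x * expR (- x).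
  by rewrite ler_wpM2l ?expR_ge0// expR_ge1Dx.
rewrite -expRD subrr expR0; lra.
Qed.

Lemma expRB1_bound (x : R) : `|expR x - 1| <= `|x| * expR `|x|.
Proof.
have h1 := expR_ge1Dx x.
have [x0|x0] := leP 0 x.
  rewrite (ger0_norm x0) ger0_norm; last lra.
  exact: expRB1_le.
rewrite ler0_norm; last by rewrite subr_le0 -expR0 ler_expR ltW.
rewrite (@le_trans _ _ `|x|)//; first by rewrite ltr0_norm//; lra.
by rewrite ler_peMr// -expR0 ler_expR.
Qed.

Lemma expRB1B_bound (x : R) : `|expR x - 1 - x| <= `|x| ^+ 2 * expR `|x|.
Proof.
have h1 := expR_ge1Dx x; have h2 := expRB1_le x.
rewrite ger0_norm; last lra.
have [x0|x0] := leP 0 x.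
  rewrite (ger0_norm x0).
  have : x * (expR x - 1) <= x * (x * expR x) by rewrite ler_wpM2l.
  rewrite expr2; lra.
apply: (@le_trans _ _ (`|x| ^+ 2)); last first.
  by rewrite ler_peMr ?sqr_ge0// -expR0 ler_expR.
have : (- x) * (1 - expR x) <= (- x) * (- x) by rewrite ler_wpM2l//; lra.
rewrite real_normK ?num_real// expr2; lra.
Qed.

End real_bounds.

Section complex_valued.
Context {R : realType}.
Implicit Types a b w : R[i].

Lemma complex_ext a b : cRe a = cRe b -> cIm a = cIm b -> a = b.
Proof. by case: a b => [? ?] [? ?] /= -> ->. Qed.

Lemma ReM a b : cRe (a * b) = cRe a * cRe b - cIm a * cIm b.
Proof. by case: a b => [? ?] []. Qed.

Lemma ImM a b : cIm (a * b) = cRe a * cIm b + cIm a * cRe b.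
Proof. by case: a b => [? ?] []. Qed.

Lemma ReD a b : cRe (a + b) = cRe a + cRe b.
Proof. by case: a b => [? ?] []. Qed.

Lemma ImD a b : cIm (a + b) = cIm a + cIm b.
Proof. by case: a b => [? ?] []. Qed.

Lemma ReJ a : cRe (conjc a) = cRe a.
Proof. by case: a. Qed.

Lemma ImJ a : cIm (conjc a) = - cIm a.
Proof. by case: a. Qed.

Lemma normc_Re a : `|cRe a| <= normc a.
Proof.
case: a => x y /=; rewrite -sqrtr_sqr ler_wsqrtr// lerDl; exact: sqr_ge0.
Qed.

Lemma normc_Im a : `|cIm a| <= normc a.
Proof.
case: a => x y /=; rewrite -sqrtr_sqr ler_wsqrtr// lerDr; exact: sqr_ge0.
Qed.

Lemma normc_le a : normc a <= `|cRe a| + `|cIm a|.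
Proof.
case: a => x y /=; rewrite -[leRHS]ger0_norm ?addr_ge0// -sqrtr_sqr ler_wsqrtr//.
rewrite -[x ^+ 2]real_normK ?num_real// -[y ^+ 2]real_normK ?num_real// sqrrD.
by rewrite addrAC lerDl mulrn_wge0// mulr_ge0.
Qed.

Lemma normcR (x : R) : normc x%:C = `|x|.
Proof. by rewrite /= expr0n/= addr0 sqrtr_sqr. Qed.

Lemma normc_conj a : normc (conjc a) = normc a.
Proof. by case: a => x y /=; rewrite sqrrN. Qed.

Lemma normcN a : normc (- a) = normc a.
Proof. by case: a => x y /=; rewrite !sqrrN. Qed.

Lemma normc_i : normc ('i%C : R[i]) = 1.
Proof. by rewrite /= expr0n expr1n/= add0r sqrtr1. Qed.

Lemma normc_cexp w : normc (cexp w) = expR (cRe w).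
Proof.
rewrite /cexp Normc.normcM normcR ger0_norm ?expR_ge0//= cos2Dsin2 sqrtr1 mulr1//.
Qed.

Lemma cexpD a b : cexp (a + b) = cexp a * cexp b.
Proof.
apply: complex_ext; rewrite /cexp !(ReM, ImM, ReD, ImD)/= expRD ?cosD ?sinD; ring.
Qed.

(** Second-order Taylor estimate of the exponential at 0. With [w = x + i y] the
    real part of the remainder is [(e^x - 1 - x) + e^x (cos y - 1)] and the
    imaginary part is [(e^x - 1) sin y + (sin y - y)]; each of the four terms is
    at most [|w|^2 e^|w|]. *)
Lemma cexp_bound w :
  normc (cexp w - 1 - w) <= 4 * normc w ^+ 2 * expR (normc w).
Proof.
set N := normc w; set x := cRe w; set y := cIm w.
have xN : `|x| <= N := normc_Re w; have yN : `|y| <= N := normc_Im w.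
have N0 : 0 <= N := normc_ge0 w.
have eN : 1 <= expR N by rewrite -expR0 ler_expR.
have exN : expR `|x| <= expR N by rewrite ler_expR.
have ex : expR x <= expR N by rewrite ler_expR (le_trans (ler_norm _)).
have x2 : `|x| ^+ 2 <= N ^+ 2 by rewrite ler_sqr.
have y2 : `|y| ^+ 2 <= N ^+ 2 by rewrite ler_sqr.
have re : cRe (cexp w - 1 - w) = (expR x - 1 - x) + expR x * (cos y - 1).
  by rewrite /cexp/= /x/y; case: w {N x y xN yN N0 eN exN ex x2 y2} => p q /=; ring.
have im : cIm (cexp w - 1 - w) = (expR x - 1) * sin y + (sin y - y).
  by rewrite /cexp/= /x/y; case: w {N x y xN yN N0 eN exN ex x2 y2 re} => p q /=; ring.
have N2 : 0 <= N ^+ 2 by exact: sqr_ge0.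
have b1 : `|expR x - 1 - x| <= N ^+ 2 * expR N.
  apply: le_trans (expRB1B_bound x) _; apply: ler_pM => //.
have b2 : `|expR x * (cos y - 1)| <= N ^+ 2 * expR N.
  rewrite normrM mulrC (ger0_norm (expR_ge0 x)); apply: ler_pM => //.
  exact: le_trans (cosB1_bound y) _.
have b3 : `|(expR x - 1) * sin y| <= N ^+ 2 * expR N.
  rewrite normrM mulrC expr2 -mulrA; apply: ler_pM => //.
    exact: le_trans (sin_bound y) _.
  apply: le_trans (expRB1_bound x) _; exact: ler_pM.
have b4 : `|sin y - y| <= N ^+ 2 * expR N.
  apply: le_trans (sinB_bound y) _; rewrite -[leLHS]mulr1.
  by apply: ler_pM.
apply: le_trans (normc_le _) _; rewrite re im.
apply: le_trans (lerD (ler_normD _ _) (ler_normD _ _)) _.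
rewrite -mulrA; lra.
Qed.

(** Smoothness and integrals are defined on real and imaginary parts; continuity
    and derivatives are taken componentwise here to match. *)
Definition ccont {T : topologicalType} (f : T -> R[i]) : Prop :=
  continuous (fun t => cRe (f t)) /\ continuous (fun t => cIm (f t)).

Lemma ccont_cst (T : topologicalType) a : ccont (fun _ : T => a).
Proof. by split => t; exact: cst_continuous. Qed.

Lemma ccontR (T : topologicalType) (f : T -> R) : continuous f ->
  ccont (fun t => (f t)%:C).
Proof. by move=> cf; split => //= t; exact: cst_continuous. Qed.

Lemma ccontD (T : topologicalType) (f g : T -> R[i]) : ccont f -> ccont g ->
  ccont (fun t => f t + g t).
Proof.
move=> [f1 f2] [g1 g2]; split => t.
  under eq_fun do rewrite ReD.
  exact: (cvgD (f1 t) (g1 t)).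
under eq_fun do rewrite ImD.
exact: (cvgD (f2 t) (g2 t)).
Qed.

Lemma ccontM (T : topologicalType) (f g : T -> R[i]) : ccont f -> ccont g ->
  ccont (fun t => f t * g t).
Proof.
move=> [f1 f2] [g1 g2]; split => t.
  under eq_fun do rewrite ReM.
  exact: (cvgB (cvgM (f1 t) (g1 t)) (cvgM (f2 t) (g2 t))).
under eq_fun do rewrite ImM.
exact: (cvgD (cvgM (f1 t) (g2 t)) (cvgM (f2 t) (g1 t))).
Qed.

Lemma ccont_conj (T : topologicalType) (f : T -> R[i]) : ccont f ->
  ccont (fun t => conjc (f t)).
Proof.
move=> [f1 f2]; split => t.
  by under eq_fun do rewrite ReJ; exact: f1.
by under eq_fun do rewrite ImJ; apply: cvgN; exact: f2.
Qed.

Lemma ccont_sum (T : topologicalType) n (f : 'I_n -> T -> R[i]) :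
  (forall i, ccont (f i)) -> ccont (fun t => \sum_i f i t).
Proof.
elim: n f => [|n IH] f cf.
  by under eq_fun do rewrite big_ord0; exact: ccont_cst.
by under eq_fun do rewrite big_ord_recl; apply: ccontD => //; exact: IH.
Qed.

Lemma ccont_cexp (T : topologicalType) (f : T -> R[i]) : ccont f ->
  ccont (fun t => cexp (f t)).
Proof.
move=> [f1 f2]; apply: ccontM.
  apply: ccontR => t; apply: (@continuous_comp _ _ _ (fun t => cRe (f t)) expR).
    exact: f1.
  exact: continuous_expR.
split => t /=.
  apply: (@continuous_comp _ _ _ (fun t => cIm (f t)) cos); first exact: f2.
  exact: continuous_cos.
apply: (@continuous_comp _ _ _ (fun t => cIm (f t)) sin); first exact: f2.
exact: continuous_sin.
Qed.

Lemma ccont_comp (T U : topologicalType) (h : T -> U) (f : U -> R[i]) :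
  continuous h -> ccont f -> ccont (fun t => f (h t)).
Proof.
move=> ch [f1 f2]; split => t.
  by apply: (@continuous_comp _ _ _ h (fun u => cRe (f u))); [exact: ch|exact: f1].
by apply: (@continuous_comp _ _ _ h (fun u => cIm (f u))); [exact: ch|exact: f2].
Qed.

Definition is_cderive (f : R -> R[i]) (x : R) (d : R[i]) : Prop :=
  is_derive x 1 (fun s => cRe (f s)) (cRe d) /\
  is_derive x 1 (fun s => cIm (f s)) (cIm d).

Lemma is_cderive_eq f x a b : is_cderive f x a -> a = b -> is_cderive f x b.
Proof. by move=> ? <-. Qed.

Lemma is_cderiveM (f g : R -> R[i]) x a b :
  is_cderive f x a -> is_cderive g x b ->
  is_cderive (fun s => f s * g s) x (a * g x + f x * b).
Proof.
move=> [f1 f2] [g1 g2]; split.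
  under eq_fun do rewrite ReM.
  apply: (is_derive_eq (is_deriveB (is_deriveM f1 g1) (is_deriveM f2 g2))).
  by rewrite ReD !ReM /GRing.scale/=; ring.
under eq_fun do rewrite ImM.
apply: (is_derive_eq (is_deriveD (is_deriveM f1 g2) (is_deriveM f2 g1))).
by rewrite ImD !ImM /GRing.scale/=; ring.
Qed.

Lemma is_cderive_conj (f : R -> R[i]) x a :
  is_cderive f x a -> is_cderive (fun s => conjc (f s)) x (conjc a).
Proof.
move=> [f1 f2]; split.
  by under eq_fun do rewrite ReJ; rewrite ReJ.
by under eq_fun do rewrite ImJ; rewrite ImJ; apply: is_deriveN.
Qed.

Lemma is_cderive_cst a x : is_cderive (fun=> a) x 0.
Proof. by split; exact: is_derive_cst. Qed.

Lemma is_derive_affine (a b x : R) : is_derive x 1 (fun s => a + s * b) b.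
Proof.
apply: is_derive_eq; rewrite /GRing.scale/=; ring.
Qed.

Lemma is_cderive_affine a b x : is_cderive (fun s => a + s%:C * b) x b.
Proof.
split.
  under eq_fun do rewrite ReD ReM/= mul0r subr0.
  exact: is_derive_affine.
under eq_fun do rewrite ImD ImM/= mul0r addr0.
exact: is_derive_affine.
Qed.

Lemma is_cderive_comp (f : R -> R[i]) (a b x : R) d :
  is_cderive f (a + x * b) d -> is_cderive (fun s => f (a + s * b)) x (b%:C * d).
Proof.
have da := is_derive_affine a b x.
move=> [f1 f2]; split.
  have := @is_derive1_comp _ (fun s => cRe (f s)) (fun s => a + s * b) x _ _ f1 da.
  by rewrite ReM/= mul0r subr0 mulrC.
have := @is_derive1_comp _ (fun s => cIm (f s)) (fun s => a + s * b) x _ _ f2 da.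
by rewrite ImM/= mul0r addr0 mulrC.
Qed.

Lemma is_cderive_cexp (f : R -> R[i]) x a :
  is_cderive f x a -> is_cderive (fun s => cexp (f s)) x (a * cexp (f x)).
Proof.
move=> [f1 f2].
have d1 := @is_derive1_comp _ expR _ x _ _ (is_derive_expR _) f1.
have d2 := @is_derive1_comp _ cos _ x _ _ (is_derive_cos _) f2.
have d3 := @is_derive1_comp _ sin _ x _ _ (is_derive_sin _) f2.
have e1 : is_cderive (fun s => (expR (cRe (f s)))%:C) x
    (expR (cRe (f x)) * cRe a)%:C by split => //=; exact: is_derive_cst.
have e2 : is_cderive (fun s => cos (cIm (f s)) +i* sin (cIm (f s))) x
  ((- sin (cIm (f x)) * cIm a) +i* (cos (cIm (f x)) * cIm a)) by split.
apply: is_cderive_eq (is_cderiveM e1 e2) _.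
by apply: complex_ext; rewrite /cexp !(ReM, ImM, ReD, ImD)/=; ring.
Qed.

End complex_valued.

(** * Integrals of complex-valued functions over R^n *)

Section integral_Rn_theory.
Context {R : realType} {n : nat}.
Implicit Types f g : 'rV[R]_n -> R[i].
Notation lam := (lebesgue_Rn R n).

Definition row_weight (t : 'rV[R]_n) : R := expR (- \sum_i `|t ord0 i|).

Definition dominated (C : R) f := forall t, normc (f t) <= C * row_weight t.

Definition total_weight : R := \int[lam]_s exp_weight s.

Lemma exp_weightE (s : n.-tuple (measurableTypeR R)) :
  exp_weight s = row_weight (row_of_tuple s).
Proof.
by rewrite /exp_weight/row_weight; under [in RHS]eq_bigr do rewrite mxE.
Qed.

Lemma total_weight_ge0 : 0 <= total_weight.
Proof. by apply: Rintegral_ge0 => s _; exact: expR_ge0. Qed.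

Lemma integrable_row (h : 'rV[R]_n -> R) C : continuous h ->
  (forall t, `|h t| <= C * row_weight t) ->
  lam.-integrable setT (fun s => (h (row_of_tuple s))%:E).
Proof.
move=> ch hC; apply: (@integrable_exp_weight_le _ _ (fun s => h (row_of_tuple s)) C).
  exact: continuous_measurable_row.
by move=> s; rewrite exp_weightE.
Qed.

Lemma Rintegral_row_bound (h : 'rV[R]_n -> R) C : continuous h ->
  (forall t, `|h t| <= C * row_weight t) ->
  `|\int[lam]_s h (row_of_tuple s)| <= C * total_weight.
Proof.
move=> ch hC; have ih := integrable_row ch hC.
apply: (le_trans (le_normr_Rintegral _ ih)) => //.
rewrite -RintegralZl//; last exact: integrable_exp_weight.
apply: le_Rintegral => //.
- have := integrable_abse ih; by [].
- have := integrableZl measurableT C (@integrable_exp_weight R n); by [].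
- by move=> s _; rewrite exp_weightE.
Qed.

Lemma dominated_Re C f : dominated C f ->
  forall t, `|cRe (f t)| <= C * row_weight t.
Proof. by move=> fC t; exact: le_trans (normc_Re _) (fC t). Qed.

Lemma dominated_Im C f : dominated C f ->
  forall t, `|cIm (f t)| <= C * row_weight t.
Proof. by move=> fC t; exact: le_trans (normc_Im _) (fC t). Qed.

(** All functions integrated over [R^n] below are continuous and dominated. *)
Lemma integrable_Rn_dominated C f : ccont f -> dominated C f -> integrable_Rn f.
Proof.
move=> [f1 f2] fC; split.
  by apply: (integrable_row f1 (dominated_Re fC)).
by apply: (integrable_row f2 (dominated_Im fC)).
Qed.

(** The factor 2 comes from estimating real and imaginary parts separately. *)
Lemma integral_Rn_bound C f : ccont f -> dominated C f ->
  normc (integral_Rn f) <= 2 * C * total_weight.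
Proof.
move=> [f1 f2] fC; apply: le_trans (normc_le _) _ => /=.
rewrite -mulrA mulr_natl mulr2n; apply: lerD.
  exact: Rintegral_row_bound f1 (dominated_Re fC).
exact: Rintegral_row_bound f2 (dominated_Im fC).
Qed.

Let integrable_scale c (h : n.-tuple (measurableTypeR R) -> R) :
  lam.-integrable setT (EFin \o h) ->
  lam.-integrable setT (EFin \o (fun s => c * h s)).
Proof. by move=> ih; have := integrableZl measurableT c ih. Qed.

Lemma integrable_RnZD a f g : integrable_Rn f -> integrable_Rn g ->
  integrable_Rn (fun t => a * f t + g t).
Proof.
move=> [f1 f2] [g1 g2].
have zf1 := integrable_scale (cRe a) f1; have zf2 := integrable_scale (cIm a) f2.
have zf3 := integrable_scale (cRe a) f2; have zf4 := integrable_scale (cIm a) f1.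
have d1 := integrableD measurableT (integrableB measurableT zf1 zf2) g1.
have d2 := integrableD measurableT (integrableD measurableT zf3 zf4) g2.
split.
  refine (eq_ind _ (integrable lam setT) d1 _ _).
  by apply/funext => s; rewrite /= ReD ReM EFinD EFinB.
refine (eq_ind _ (integrable lam setT) d2 _ _).
by apply/funext => s; rewrite /= ImD ImM !EFinD.
Qed.

Lemma integral_RnZD a f g : integrable_Rn f -> integrable_Rn g ->
  integral_Rn (fun t => a * f t + g t) = a * integral_Rn f + integral_Rn g.
Proof.
move=> [f1 f2] [g1 g2].
have zf1 := integrable_scale (cRe a) f1; have zf2 := integrable_scale (cIm a) f2.
have zf3 := integrable_scale (cRe a) f2; have zf4 := integrable_scale (cIm a) f1.
have b := integrableB measurableT zf1 zf2.
have d := integrableD measurableT zf3 zf4.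
apply: complex_ext; rewrite ?(ReD, ImD, ReM, ImM)/=.
  rewrite -!RintegralZl// -RintegralB// -RintegralD//.
  by apply: eq_Rintegral => s _; rewrite ReD ReM.
rewrite -!RintegralZl// -RintegralD// -RintegralD//.
by apply: eq_Rintegral => s _; rewrite ImD ImM.
Qed.

(** Changing one coordinate of a tuple is moving along a coordinate line of the
    vector space, which links Fubini to directional derivatives. *)
Lemma row_set_tnth (j : 'I_n) (y : R) (s : n.-tuple (measurableTypeR R)) :
  row_of_tuple (set_tnth j y s) =
  row_of_tuple (set_tnth j 0 s) + y *: delta_mx ord0 j.
Proof.
apply/rowP => i; rewrite !mxE !tnth_mktuple eqxx andTb.
by case: (i == j); rewrite ?mulr1 ?add0r// mulr0 addr0.
Qed.

Lemma continuous_line (t v : 'rV[R]_n) : continuous (fun y : R => t + y *: v).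
Proof.
by move=> y; apply: cvgD; [exact: cvg_cst|apply: cvgZl; exact: cvg_id].
Qed.

(** The boundary-free form of integration by parts. *)
Lemma integral_Rn_partial_eq0 (j : 'I_n) C f df :
  ccont f -> ccont df -> dominated C f -> dominated C df ->
  (forall t y, is_cderive (fun y => f (t + y *: delta_mx ord0 j)) y
     (df (t + y *: delta_mx ord0 j))) ->
  integral_Rn df = 0.
Proof.
move=> [f1 f2] [g1 g2] fC gC dF.
have key (h dh : 'rV[R]_n -> R) : continuous h -> continuous dh ->
    (forall t, `|h t| <= C * row_weight t) ->
    (forall t, `|dh t| <= C * row_weight t) ->
    (forall t (y : R), is_derive y 1 (fun y => h (t + y *: delta_mx ord0 j))
       (dh (t + y *: delta_mx ord0 j))) -> \int[lam]_s dh (row_of_tuple s) = 0.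
  move=> ch cdh hC dhC dh'; rewrite /Rintegral.
  have d s (y : R) : is_derive y 1 (fun y => h (row_of_tuple (set_tnth j y s)))
      (dh (row_of_tuple (set_tnth j y s))).
    by rewrite row_set_tnth; under eq_fun do rewrite row_set_tnth.
  have cd s : continuous (fun y => dh (row_of_tuple (set_tnth j y s))).
    under eq_fun do rewrite row_set_tnth.
    move=> y; apply: (@continuous_comp _ _ _ (fun y : R =>
      row_of_tuple (set_tnth j 0 s) + y *: delta_mx ord0 j) dh).
      exact: continuous_line.
    exact: cdh.
  rewrite (@integral_partial_eq0 _ _ j (fun s => h (row_of_tuple s))
    (fun s => dh (row_of_tuple s)) C (continuous_measurable_row ch)
    (continuous_measurable_row cdh) d cd)//.
  - by move=> s; rewrite exp_weightE.
  - by move=> s; rewrite exp_weightE.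
apply: complex_ext => /=.
  by apply: (key _ _ f1 g1 (dominated_Re fC) (dominated_Re gC)) => t y; have [] := dF t y.
by apply: (key _ _ f2 g2 (dominated_Im fC) (dominated_Im gC)) => t y; have [] := dF t y.
Qed.

(** Differentiation under the integral sign; the domination is uniform in the
    parameter because the integrand of the transform satisfies such a bound. *)
Lemma integral_Rn_cderive C (f df : R -> 'rV[R]_n -> R[i]) x : 0 <= C ->
  (forall y, ccont (f y)) ->
  (forall y, dominated C (f y)) -> (forall y, dominated C (df y)) ->
  (forall y t, is_cderive (f ^~ t) y (df y t)) ->
  is_cderive (fun y => integral_Rn (f y)) x (integral_Rn (df x)).
Proof.
move=> C0 cf fC gC dF.
have key (h dh : R -> 'rV[R]_n -> R) : (forall y, continuous (h y)) ->
    (forall y t, `|h y t| <= C * row_weight t) ->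
    (forall y t, `|dh y t| <= C * row_weight t) ->
    (forall t (y : R), is_derive y 1 (h ^~ t) (dh y t)) ->
    is_derive x 1 (fun y => \int[lam]_s h y (row_of_tuple s))
      (\int[lam]_s dh x (row_of_tuple s)).
  move=> ch hC dhC dh'.
  have pE y s : partial1of2 (fun y s => h y (row_of_tuple s)) y s = dh y (row_of_tuple s).
    by rewrite partial1of2E; apply: derive_val.
  (* Any neighbourhood of [x] will do, the domination being uniform. *)
  have xI : [set` `]x - 1, x + 1[ ] x by rewrite /= in_itv/= ltrBlDr ltrDl ltr01.
  have iG : lam.-integrable setT (EFin \o (fun s => C * exp_weight s)).
    by have := integrableZl measurableT C (@integrable_exp_weight R n).
  have G0 (s : n.-tuple (measurableTypeR R)) : 0 <= C * exp_weight s :> R.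
    by rewrite mulr_ge0// expR_ge0.
  have ih y : [set` `]x - 1, x + 1[ ] y ->
      lam.-integrable setT (EFin \o (fun s => h y (row_of_tuple s))).
    by move=> _; exact: integrable_row (ch y) (hC y).
  have d1 y s : [set` `]x - 1, x + 1[ ] y -> setT s ->
      derivable (fun y => h y (row_of_tuple s)) y 1.
    by move=> _ _; have [] := dh' (row_of_tuple s) y.
  have ub y s : [set` `]x - 1, x + 1[ ] y -> setT s ->
      `|partial1of2 (fun y s => h y (row_of_tuple s)) y s| <= C * exp_weight s.
    by move=> _ _; rewrite pE exp_weightE.
  split.
    exact: (derivable_under_integral measurableT xI ih d1 G0 iG ub).
  rewrite -derive1E (differentiation_under_integral measurableT xI ih d1 G0 iG ub).
  by apply: eq_Rintegral => s _; rewrite pE.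
split.
  by apply: (key _ (fun y t => cRe (df y t)) (fun y => (cf y).1)
    (fun y => dominated_Re (fC y)) (fun y => dominated_Re (gC y))) => t y; have [] := dF y t.
by apply: (key _ (fun y t => cIm (df y t)) (fun y => (cf y).2)
  (fun y => dominated_Im (fC y)) (fun y => dominated_Im (gC y))) => t y; have [] := dF y t.
Qed.

End integral_Rn_theory.

(** * Weights and the size of the integrand *)

Section weights.
Context {R : realType} {n : nat}.

Lemma enorm_ge0 m (t : 'rV[R]_m) : 0 <= enorm t.
Proof. exact: sqrtr_ge0. Qed.

Lemma coord_le_enorm m (t : 'rV[R]_m) i : `|t ord0 i| <= enorm t.
Proof.
rewrite -sqrtr_sqr /enorm ler_wsqrtr// (bigD1 i)//= lerDl.
by apply: sumr_ge0 => j _; exact: sqr_ge0.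
Qed.

Lemma sum_coord_le_enorm m (t : 'rV[R]_m) : \sum_i `|t ord0 i| <= m%:R * enorm t.
Proof.
apply: (@le_trans _ _ (\sum_(i < m) enorm t)).
  by apply: ler_sum => i _; exact: coord_le_enorm.
by rewrite sumr_const card_ord -[leLHS]mulr_natl.
Qed.

Lemma enorm_const_mx (s : R) : enorm (const_mx s : 'rV[R]_1) = `|s|.
Proof. by rewrite /enorm big_ord_recl big_ord0 mxE addr0 sqrtr_sqr. Qed.

(** A crude substitute for the Cauchy-Schwarz inequality: the extra factor [n]
    only enlarges the order of the seminorms in the final estimate. *)
Lemma dot_le (u t : 'rV[R]_n) : enorm u = 1 -> `|dot u t| <= n%:R * enorm t.
Proof.
move=> u1; apply: le_trans (sum_coord_le_enorm t).
apply: le_trans (ler_norm_sum _ _ _) _; apply: ler_sum => i _.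
by rewrite normrM ler_piMl// -u1 coord_le_enorm.
Qed.

Lemma Im_cdot (t : 'rV[R]_n) z : cIm (cdot t z) = \sum_i t ord0 i * cIm (z ord0 i).
Proof.
rewrite /cdot; elim/big_rec2 : _ => [//|i a b _ <-].
by rewrite ImD ImM/= mul0r addr0.
Qed.

(** The exponent of the Fourier kernel. *)
Definition phase (t : 'rV[R]_n) (z : 'rV[R[i]]_n) : R[i] :=
  - ((2 * pi)%:C * 'i%C * cdot t z).

Lemma Re_phase t z : cRe (phase t z) = 2 * pi * cIm (cdot t z).
Proof. by rewrite /phase; case: (cdot t z) => a b /=; ring. Qed.

Lemma phaseD t z h : phase t (z + h) = phase t z + phase t h.
Proof.
rewrite /phase /cdot -opprD -mulrDr -big_split/=; congr (- (_ * _)).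
by apply: eq_bigr => i _; rewrite mxE mulrDr.
Qed.

Lemma twopi_le8 : 2 * pi <= 8 :> R.
Proof. have := @pihalf_lt2 R; lra. Qed.

Lemma Re_phase_le (k : nat) t z : tube k z ->
  cRe (phase t z) <= 8 * k%:R * n%:R * enorm t.
Proof.
move=> kz; rewrite Re_phase Im_cdot.
have p0 := @pi_gt0 R.
apply: (@le_trans _ _ (8 * (k%:R * (n%:R * enorm t)))); last by rewrite !mulrA.
have h : \sum_i t ord0 i * cIm (z ord0 i) <= k%:R * (n%:R * enorm t).
  apply: (@le_trans _ _ (k%:R * \sum_i `|t ord0 i|)).
    rewrite mulr_sumr; apply: ler_sum => i _.
    rewrite (le_trans (ler_norm _))// normrM mulrC.
    by rewrite ler_wpM2r// kz.
  by rewrite ler_wpM2l// sum_coord_le_enorm.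
apply: (@le_trans _ _ (2 * pi * (k%:R * (n%:R * enorm t)))).
  by rewrite ler_wpM2l// mulr_ge0// ltW.
by rewrite ler_wpM2r ?twopi_le8// !mulr_ge0// enorm_ge0.
Qed.

Lemma normc_phase_le t (h : 'rV[R[i]]_n) (r : R) : (forall i, normc (h ord0 i) <= r) ->
  normc (phase t h) <= 8 * n%:R * enorm t * r.
Proof.
move=> hr; rewrite /phase -mulrA normcN Normc.normcM normcR.
rewrite ger0_norm ?mulr_ge0 ?pi_ge0// Normc.normcM.
rewrite normc_i mul1r.
have h1 : normc (cdot t h) <= n%:R * enorm t * r.
  have : normc (cdot t h) <= \sum_i `|t ord0 i| * r.
    rewrite /cdot; elim/big_rec2 : _ => [|i a b _ ab]; first by rewrite Normc.normc0.
    apply: le_trans (le_normcD _ _) _; apply: lerD => //.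
    by rewrite Normc.normcM normcR ler_wpM2l.
  move/le_trans; apply; rewrite -mulr_suml.
  have [n0|n0] := posnP n.
    rewrite big1 ?mul0r => [|i _]; last by have := ltn_ord i; rewrite {2}n0.
    by have -> : n%:R = 0 :> R by [rewrite n0]; rewrite !mul0r.
  have r0 : 0 <= r := le_trans (normc_ge0 _) (hr (Ordinal n0)).
  by rewrite ler_wpM2r// sum_coord_le_enorm.
apply: (@le_trans _ _ (8 * normc (cdot t h))); last by rewrite -!mulrA ler_wpM2l// !mulrA.
by rewrite ler_wpM2r ?normc_ge0// twopi_le8.
Qed.

Lemma expR_le_row_weight (t : 'rV[R]_n) : expR (- (n%:R * enorm t)) <= row_weight t.
Proof. by rewrite ler_expR lerN2 sum_coord_le_enorm. Qed.

Definition rapid m (N : nat) (A : R) (f : 'rV[R]_m -> R[i]) : Prop :=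
  forall t, normc (f t) <= A * expR (- (N%:R * enorm t)).

Lemma DS_integrandE (u : 'rV[R]_n) (phi : 'rV[R]_n -> R[i]) g x z t :
  DS_integrand u phi g x z t =
  phi t * conjc (g (const_mx (dot u t - x))) * cexp (phase t z).
Proof. by []. Qed.

(** Since [|x| <= |u.t| + |u.t - x|], the weight [e^(k|x|)] is absorbed by the
    decay of [phi] at [t] and of [g] at [u.t - x]. In the tube of width [k] the
    kernel is at most [e^(2 pi k n |t|)], which the decay of [phi] absorbs as
    well. The integer [m] measures decay left over for further factors. *)
Lemma DS_integrand_bound (u : 'rV[R]_n) (phi : 'rV[R]_n -> R[i])
    (g : 'rV[R]_1 -> R[i]) (x : R) z (k m N : nat) (A B : R) t :
  enorm u = 1 -> tube k z -> (k <= N)%N -> ((9 * k + m + 1) * n <= N)%N ->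
  rapid N A phi -> rapid N B g ->
  expR (k%:R * `|x|) * normc (DS_integrand u phi g x z t) <=
  A * B * expR (- (m%:R * n%:R * enorm t)) * row_weight t.
Proof.
move=> u1 kz kN mN rphi rg.
rewrite DS_integrandE Normc.normcM normc_cexp Normc.normcM normc_conj.
set s := dot u t - x; set T := enorm t.
have hp := rphi t; have hg := rg (const_mx s); rewrite enorm_const_mx in hg.
have hz := Re_phase_le t kz.
have T0 : 0 <= T := enorm_ge0 t.
have A0 : 0 <= A.
  by have := le_trans (normc_ge0 _) hp; rewrite pmulr_lge0// expR_gt0.
have B0 : 0 <= B.
  by have := le_trans (normc_ge0 _) hg; rewrite pmulr_lge0// expR_gt0.
have xs : `|x| <= n%:R * T + `|s|.
  have -> : x = dot u t - s by rewrite /s opprB addrCA subrr addr0.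
  by rewrite (le_trans (ler_normB _ _))// lerD2r dot_le.
apply: (@le_trans _ _ (expR (k%:R * (n%:R * T + `|s|)) *
   (A * expR (- (N%:R * T)) * (B * expR (- (N%:R * `|s|))) *
    expR (8 * k%:R * n%:R * T)))).
  apply: ler_pM => //.
  - by rewrite !mulr_ge0 ?normc_ge0// expR_ge0.
  - by rewrite ler_expR ler_wpM2l.
  - apply: ler_pM => //; [by rewrite mulr_ge0 ?normc_ge0| |].
      by apply: ler_pM; rewrite ?normc_ge0.
    by rewrite ler_expR.
apply: (@le_trans _ _ (A * B * expR (- (m%:R * n%:R * T)) * expR (- (n%:R * T)))); last first.
  apply: ler_wpM2l; last exact: expR_le_row_weight.
  by rewrite !mulr_ge0// expR_ge0.
rewrite (_ : _ * (_ * _ * _ * _) = A * B * (expR (k%:R * (n%:R * T + `|s|)) *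
   expR (- (N%:R * T)) * expR (- (N%:R * `|s|)) * expR (8 * k%:R * n%:R * T))); last by ring.
rewrite -[leRHS]mulrA ler_wpM2l ?mulr_ge0// -!expRD ler_expR.
have kN' : k%:R <= N%:R :> R by rewrite ler_nat.
have mN' : (9 * k%:R + m%:R + 1) * n%:R <= N%:R :> R.
  have : ((9 * k + m + 1) * n)%N%:R <= N%:R :> R by rewrite ler_nat.
  by rewrite !(natrM, natrD).
have h1 : k%:R * `|s| <= N%:R * `|s| by rewrite ler_wpM2r.
have h2 : (9 * k%:R + m%:R + 1) * n%:R * T <= N%:R * T by rewrite ler_wpM2r.
lra.
Qed.

Lemma DS_integrand_dominated (u : 'rV[R]_n) (phi : 'rV[R]_n -> R[i])
    (g : 'rV[R]_1 -> R[i]) (x : R) z (k N : nat) (A B : R) :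
  enorm u = 1 -> tube k z -> (k <= N)%N -> ((9 * k + 1) * n <= N)%N ->
  rapid N A phi -> rapid N B g ->
  dominated (expR (- (k%:R * `|x|)) * (A * B)) (DS_integrand u phi g x z).
Proof.
move=> u1 kz kN mN rphi rg t.
have mN' : ((9 * k + 0 + 1) * n <= N)%N by rewrite addn0.
have := DS_integrand_bound x t u1 kz kN mN' rphi rg.
rewrite !mul0r oppr0 expR0 mulr1 => h.
by rewrite -mulrA expRN ler_pdivlMl ?expR_gt0.
Qed.

Lemma continuous_dot (u : 'rV[R]_n) : continuous (dot u).
Proof.
apply: (@continuous_big R _ +%R 0 predT _ _ _
  (fun i (t : 'rV[R]_n) => u ord0 i * t ord0 i)) => [|i _].
  exact: add_continuous.
by move=> t; exact: (cvgM (cvg_cst _) (@coord_continuous _ _ _ ord0 i t)).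
Qed.

Lemma continuous_const_mx : continuous (fun s : R => const_mx s : 'rV[R]_1).
Proof.
move=> s; apply/cvgrPdist_le => e e0; near=> r.
apply: rV_norm_le => [|i]; first exact: ltW.
rewrite !mxE; near: r; apply: cvgr_dist_le => //; exact: cvg_id.
Unshelve. all: by end_near. Qed.

Lemma ccont_phase z : ccont (fun t => phase t z).
Proof.
have -> : (fun t => phase t z) = (fun t => (- ((2 * pi)%:C * 'i%C)) * cdot t z).
  by apply/funext => t; rewrite /phase mulNr.
apply: ccontM; first exact: ccont_cst.
apply: ccont_sum => i; apply: ccontM; last exact: ccont_cst.
by apply: ccontR => t; exact: coord_continuous.
Qed.

Lemma ccont_DS_integrand (u : 'rV[R]_n) (phi : 'rV[R]_n -> R[i]) g x z :
  ccont phi -> ccont g ->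
  ccont (DS_integrand u phi g x z).
Proof.
move=> cphi cg; apply: ccontM; last exact/ccont_cexp/ccont_phase.
apply: ccontM => //; apply: ccont_conj.
apply: (@ccont_comp _ _ _ (fun t => const_mx (dot u t - x)) g) => // t.
apply: (@continuous_comp _ _ _ (fun t => dot u t - x) (fun s => const_mx s)).
  exact: (cvgB (@continuous_dot u t) (cvg_cst x)).
exact: continuous_const_mx.
Qed.

End weights.

(** * Derivative in x, integration by parts and decay in z *)

Section transform_calculus.
Context {R : realType} {n : nat}.
Variable u : 'rV[R]_n.
Hypothesis u1 : enorm u = 1.

Lemma dominatedZD (a : R[i]) C D (f g : 'rV[R]_n -> R[i]) :
  dominated C f -> dominated D g ->
  dominated (normc a * C + D) (fun t => a * f t + g t).
Proof.
move=> fC gD t; apply: le_trans (le_normcD _ _) _.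
rewrite mulrDl -mulrA; apply: lerD => //.
by rewrite Normc.normcM ler_wpM2l ?normc_ge0.
Qed.

Lemma dominated_le C D (f : 'rV[R]_n -> R[i]) : C <= D -> dominated C f -> dominated D f.
Proof.
by move=> CD fC t; apply: le_trans (fC t) _; rewrite ler_wpM2r// expR_ge0.
Qed.

Lemma ccontZD (a : R[i]) (f g : 'rV[R]_n -> R[i]) : ccont f -> ccont g ->
  ccont (fun t => a * f t + g t).
Proof. by move=> cf cg; apply: ccontD => //; apply: ccontM => //; exact: ccont_cst. Qed.

Lemma rapid_ge0 m N (A : R) (f : 'rV[R]_m -> R[i]) : rapid N A f -> 0 <= A.
Proof.
move=> fA; have := le_trans (normc_ge0 _) (fA 0).
by rewrite pmulr_lge0// expR_gt0.
Qed.

Lemma dotDr (t v : 'rV[R]_n) y : dot u (t + y *: v) = dot u t + y * dot u v.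
Proof.
rewrite /dot mulr_sumr -big_split/=; apply: eq_bigr => i _.
by rewrite !mxE; ring.
Qed.

Lemma dot_delta j : dot u (delta_mx ord0 j) = u ord0 j.
Proof.
rewrite /dot (bigD1 j)//= mxE !eqxx mulr1 big1 ?addr0// => i ij.
by rewrite mxE (negbTE ij) andbF mulr0.
Qed.

Lemma phase_line (t : 'rV[R]_n) j y (z : 'rV[R[i]]_n) : phase (t + y *: delta_mx ord0 j) z =
  phase t z + y%:C * - ((2 * pi)%:C * 'i%C * z ord0 j).
Proof.
rewrite /phase; have -> : cdot (t + y *: delta_mx ord0 j) z = cdot t z + y%:C * z ord0 j.
  rewrite /cdot.
  transitivity (\sum_i ((t ord0 i)%:C * z ord0 i +
      (if i == j then y%:C * z ord0 i else 0))).
    apply: eq_bigr => i _; rewrite !mxE eqxx/=.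
    by case: (i == j); rewrite ?mulr1 ?mulr0 ?addr0// rmorphD/= mulrDl.
  by rewrite big_split/= -big_mkcond big_pred1_eq.
by ring.
Qed.

Section one_derivative.
Variables (N k : nat) (A B : R) (z : 'rV[R[i]]_n).
Hypothesis kz : tube k z.
Hypothesis kN : (k <= N)%N.
Hypothesis kN' : ((9 * k + 1) * n <= N)%N.
Variables (phi phi' : 'rV[R]_n -> R[i]) (g g' : 'rV[R]_1 -> R[i]).
Hypotheses (cphi : ccont phi) (cphi' : ccont phi') (cg : ccont g) (cg' : ccont g').
Hypotheses (Aphi : rapid N A phi) (Bg : rapid N B g) (Bg' : rapid N B g').
Hypothesis dg : forall s : R, is_cderive (fun s => g (const_mx s)) s (- g' (const_mx s)).

Let dom (p : 'rV[R]_n -> R[i]) (q : 'rV[R]_1 -> R[i]) x :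
  rapid N A p -> rapid N B q -> dominated (A * B) (DS_integrand u p q x z).
Proof.
move=> pA qB; apply: (dominated_le _ (DS_integrand_dominated x u1 kz kN kN' pA qB)).
by rewrite ler_piMl ?mulr_ge0 ?(rapid_ge0 pA) ?(rapid_ge0 qB).
Qed.

(** The hypothesis on [g] has a minus sign because [x] enters through
    [u.t - x]; the two signs cancel. *)
Lemma DS_cderive x : is_cderive (fun x => DS u phi g x z) x (DS u phi g' x z).
Proof.
apply: (@integral_Rn_cderive _ _ (A * B) (fun x => DS_integrand u phi g x z)
  (fun x => DS_integrand u phi g' x z)).
- by rewrite mulr_ge0// ?(rapid_ge0 Aphi) ?(rapid_ge0 Bg).
- by move=> y; exact: ccont_DS_integrand.
- by move=> y; exact: dom.
- by move=> y; exact: dom.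
move=> y t.
have d1 : is_cderive (fun y => g (const_mx (dot u t - y))) y (g' (const_mx (dot u t - y))).
  have e s : dot u t - s = dot u t + s * -1 by rewrite mulrN1.
  under eq_fun do rewrite e.
  apply: is_cderive_eq (is_cderive_comp (dg _)) _.
  by rewrite e; apply: complex_ext; case: (g' _) => p q /=; ring.
have d2 := is_cderiveM (is_cderiveM (is_cderive_cst (phi t) y) (is_cderive_conj d1))
   (is_cderive_cst (cexp (phase t z)) y).
apply: is_cderive_eq d2 _; rewrite DS_integrandE; ring.
Qed.

Hypothesis Aphi' : rapid N A phi'.

(** The partial derivative of the integrand in [t_j] has integral 0. It is the sum
    of three terms, according to whether the derivative falls on [phi], on [g]
    or on the kernel, and the last of them is [- 2 pi i z_j] times the
    integrand. *)
Lemma DS_parts x j :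
  (forall t (y : R), is_cderive (fun y => phi (t + y *: delta_mx ord0 j)) y
    (phi' (t + y *: delta_mx ord0 j))) ->
  (2 * pi)%:C * 'i%C * z ord0 j * DS u phi g x z =
  DS u phi' g x z - (u ord0 j)%:C * DS u phi g' x z.
Proof.
move=> dphi; set c := (2 * pi)%:C * 'i%C * z ord0 j.
pose I p q := DS_integrand u p q x z.
have ci p q : ccont p -> ccont q -> ccont (I p q) by exact: ccont_DS_integrand.
have ii p q : ccont p -> ccont q -> rapid N A p -> rapid N B q -> integrable_Rn (I p q).
  by move=> cp cq pA qB; apply: integrable_Rn_dominated (ci _ _ cp cq) (dom x pA qB).
(* The derivative is written as nested [a * f + g], the shape of
   [integral_RnZD]. *)
have df t y : is_cderive (fun y => I phi g (t + y *: delta_mx ord0 j)) y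
   (- c * I phi g (t + y *: delta_mx ord0 j) +
     (- (u ord0 j)%:C * I phi g' (t + y *: delta_mx ord0 j) +
      I phi' g (t + y *: delta_mx ord0 j))).
  have e s : dot u (t + s *: delta_mx ord0 j) - x = (dot u t - x) + s * u ord0 j.
    by rewrite dotDr dot_delta addrAC.
  have d1 : is_cderive (fun y => g (const_mx (dot u (t + y *: delta_mx ord0 j) - x))) y
      ((u ord0 j)%:C * - g' (const_mx (dot u (t + y *: delta_mx ord0 j) - x))).
    by under eq_fun do rewrite e; rewrite e; exact: is_cderive_comp (dg _).
  have d2 : is_cderive (fun y => phase (t + y *: delta_mx ord0 j) z) y (- c).
    by under eq_fun do rewrite phase_line; exact: is_cderive_affine.
  apply: is_cderive_eq
    (is_cderiveM (is_cderiveM (dphi t y) (is_cderive_conj d1)) (is_cderive_cexp d2)) _.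
  have conjE (r : R) w : conjc (r%:C * - w) = - (r%:C * conjc w).
    by apply: complex_ext; case: w => p q /=; ring.
  rewrite /I !DS_integrandE conjE; ring.
set D := normc (- c) * (A * B) + (normc (- (u ord0 j)%:C) * (A * B) + A * B).
have AB0 : 0 <= A * B by rewrite mulr_ge0 ?(rapid_ge0 Aphi) ?(rapid_ge0 Bg).
have D1 : dominated D (I phi g).
  apply: (dominated_le _ (dom x Aphi Bg)).
  by rewrite /D addrA lerDr addr_ge0// mulr_ge0// normc_ge0.
have D2 := dominatedZD (- c) (dom x Aphi Bg)
  (dominatedZD (- (u ord0 j)%:C) (dom x Aphi Bg') (dom x Aphi' Bg)).
have := integral_Rn_partial_eq0 (ci _ _ cphi cg) (ccontZD _ (ci _ _ cphi cg)
  (ccontZD _ (ci _ _ cphi cg') (ci _ _ cphi' cg))) D1 D2 df.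
have i1 := ii _ _ cphi cg Aphi Bg; have i2 := ii _ _ cphi cg' Aphi Bg'.
have i3 := ii _ _ cphi' cg Aphi' Bg.
rewrite integral_RnZD//; last exact: integrable_RnZD.
rewrite integral_RnZD// mulNr => /eqP; rewrite addrC subr_eq0 => /eqP <-.
by rewrite mulNr addrC.
Qed.

(** Each use of this inequality trades a factor [z_j] for one derivative of
    [phi] in the direction [j] or one derivative of [g]. *)
Lemma DS_parts_norm x j :
  (forall t (y : R), is_cderive (fun y => phi (t + y *: delta_mx ord0 j)) y
    (phi' (t + y *: delta_mx ord0 j))) ->
  normc (z ord0 j) * normc (DS u phi g x z) <=
  normc (DS u phi' g x z) + normc (DS u phi g' x z).
Proof.
move=> dphi; have := congr1 (@Normc.normc R) (DS_parts x dphi).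
rewrite !Normc.normcM normcR.
rewrite normc_i mulr1 => E.
apply: (@le_trans _ _ (`|2 * pi| * normc (z ord0 j) * normc (DS u phi g x z))).
  rewrite -mulrA ler_peMl ?mulr_ge0 ?normc_ge0//.
  have := @pi_ge2 R => p2; rewrite ger0_norm; lra.
rewrite E; apply: le_trans (le_normcD _ _) _; rewrite lerD2l normcN.
by rewrite Normc.normcM normcR ler_piMl ?normc_ge0// -u1 coord_le_enorm.
Qed.

Lemma DS_bound x : normc (DS u phi g x z) <=
  2 * (expR (- (k%:R * `|x|)) * (A * B)) * @total_weight R n.
Proof.
apply: integral_Rn_bound; first exact: ccont_DS_integrand.
exact: (DS_integrand_dominated x u1 kz kN kN' Aphi Bg).
Qed.

End one_derivative.

(** Iterated integration by parts in a single direction [j]: the recursion closes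
    on the pure derivatives of [phi] in that direction and the derivatives of
    [g], each step doubling the number of transforms. *)
Lemma DS_decay (N k : nat) (A B : R) z x j (phi_ : nat -> 'rV[R]_n -> R[i])
    (g_ : nat -> 'rV[R]_1 -> R[i]) (m a b : nat) :
  tube k z -> (k <= N)%N -> ((9 * k + 1) * n <= N)%N ->
  (forall p, ccont (phi_ p)) -> (forall p, ccont (g_ p)) ->
  (forall p t (y : R), is_cderive (fun y => phi_ p (t + y *: delta_mx ord0 j)) y
    (phi_ p.+1 (t + y *: delta_mx ord0 j))) ->
  (forall p (s : R), is_cderive (fun s => g_ p (const_mx s)) s (- g_ p.+1 (const_mx s))) ->
  (forall p, (p <= a + m)%N -> rapid N A (phi_ p)) ->
  (forall p, (p <= b + m)%N -> rapid N B (g_ p)) ->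
  normc (z ord0 j) ^+ m * normc (DS u (phi_ a) (g_ b) x z) <=
  2 ^+ m * (2 * (expR (- (k%:R * `|x|)) * (A * B)) * @total_weight R n).
Proof.
move=> kz kN kN' cphi cg dphi dg.
elim: m a b => [|m IH] a b Aphi Bg.
  rewrite !expr0 !mul1r; apply: (@DS_bound N) => //.
    by apply: Aphi; rewrite addn0.
  by apply: Bg; rewrite addn0.
rewrite exprSr -mulrA.
have h : normc (z ord0 j) * normc (DS u (phi_ a) (g_ b) x z) <=
    normc (DS u (phi_ a.+1) (g_ b) x z) + normc (DS u (phi_ a) (g_ b.+1) x z).
  apply: (@DS_parts_norm N k A B) => //;
    by [apply: Aphi; rewrite leq_addr|apply: Aphi; rewrite addnS ltnS leq_addr|
        apply: Bg; rewrite leq_addr|apply: Bg; rewrite addnS ltnS leq_addr].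
apply: le_trans (ler_wpM2l (exprn_ge0 m (normc_ge0 _)) h) _.
rewrite mulrDr exprS -mulrA mulr_natl mulr2n; apply: lerD.
  apply: IH => p hp; first by apply: Aphi; rewrite addnS.
  by apply: Bg; rewrite (leq_trans hp)// addnS.
apply: IH => p hp; last by apply: Bg; rewrite addnS.
by apply: Aphi; rewrite (leq_trans hp)// addnS.
Qed.

End transform_calculus.

(** * Holomorphy in z *)

(** A function that agrees with an affine one up to a quadratic error is
    differentiable over any numerical field, in particular holomorphic when the
    field is that of complex numbers. *)
Lemma differentiable_quadratic (K : numFieldType) (n : nat)
    (F : 'rV[K]_n -> K^o) (z : 'rV[K]_n) (c : 'I_n -> K) (C : K) : 0 <= C ->
  (forall h, `|h| <= 1 ->
    `|F (z + h) - F z - \sum_j h ord0 j * c j| <= C * `|h| ^+ 2) ->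
  differentiable F z.
Proof.
move=> C0 FC.
pose L (h : 'rV[K]_n) : K^o := \sum_j h ord0 j * c j.
have L_lin : linear L.
  move=> a v w; rewrite /L scaler_sumr -big_split/=; apply: eq_bigr => j _.
  by rewrite !mxE mulrDl -mulrA.
pose LM := GRing.isLinear.Build _ _ _ _ _ L_lin.
pose Lf : {linear 'rV[K]_n -> K^o} := HB.pack L LM.
have cL : continuous Lf.
  apply: (@continuous_big K^o _ +%R 0 predT _ _ _
    (fun j (h : 'rV[K]_n) => h ord0 j * c j : K^o)) => [|j _ h].
    exact: add_continuous.
  exact: (cvgM (@coord_continuous _ _ _ ord0 j h) (cvg_cst _)).
have FE : F \o shift z = cst (F z) + Lf +o_ (0 : 'rV[K]_n) id.
  apply/eqaddoP => e e0; near=> h.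
  have h1 : `|h| <= 1.
    near: h; apply/nbhs_ballP; exists 1 => //= h; rewrite -ball_normE/= sub0r normrN.
    exact: ltW.
  have hC : (C + 1) * `|h| <= e.
    near: h; apply/nbhs_ballP; exists (e / (C + 1)) => /=.
      by rewrite divr_gt0// ltr_wpDl.
    move=> h; rewrite -ball_normE/= sub0r normrN => /ltW.
    by rewrite ler_pdivlMr ?ltr_wpDl// mulrC.
  rewrite !fctE/= [h + z]addrC opprD addrA; apply: le_trans (FC h h1) _.
  rewrite expr2 mulrA ler_wpM2r// (le_trans _ hC)// ler_wpM2r//.
  by rewrite lerDl.
apply/diff_locallyP; have -> : 'd F z = Lf :> (_ -> _) by exact: diff_unique.
by [].
Unshelve. all: by end_near. Qed.

Section z_derivative.
Context {R : realType} {n : nat}.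
Notation W := (@total_weight R n).

Lemma integral_Rn0 : @integral_Rn R n (fun=> 0) = 0.
Proof. by rewrite /integral_Rn /Rintegral !integral0. Qed.

Lemma integrable_Rn0 : @integrable_Rn R n (fun=> 0).
Proof. by split; exact: integrable0. Qed.

Lemma integral_Rn_sum m (a : 'I_m -> R[i]) (f : 'I_m -> 'rV[R]_n -> R[i]) :
  (forall j, integrable_Rn (f j)) ->
  integrable_Rn (fun t => \sum_j a j * f j t) /\
  integral_Rn (fun t => \sum_j a j * f j t) = \sum_j a j * integral_Rn (f j).
Proof.
elim: m a f => [|m IH] a f intf.
  under eq_fun do rewrite big_ord0.
  by rewrite big_ord0 integral_Rn0; split => //; exact: integrable_Rn0.
have [i1 i2] := IH (fun j => a (lift ord0 j)) _ (fun j => intf (lift ord0 j)).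
have -> : (fun t => \sum_j a j * f j t) = (fun t => a ord0 * f ord0 t +
    \sum_(j < m) a (lift ord0 j) * f (lift ord0 j) t).
  by apply/funext => t; rewrite big_ord_recl.
by rewrite big_ord_recl -i2; split; [exact: integrable_RnZD|exact: integral_RnZD].
Qed.

Lemma sqr_le_expR (y : R) : 0 <= y -> y ^+ 2 <= 4 * expR y.
Proof.
move=> y0; have h : 1 + y / 2 <= expR (y / 2) := expR_ge1Dx _.
have -> : expR y = expR (y / 2) ^+ 2.
  by rewrite expr2 -expRD -splitr.
have : (y / 2) ^+ 2 <= expR (y / 2) ^+ 2.
  by rewrite ler_sqr ?nnegrE ?expR_ge0 ?divr_ge0//; lra.
rewrite expr_div_n; lra.
Qed.

(** The coefficient of [z_j] in the exponent of the Fourier kernel, that is the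
    factor produced by differentiating the kernel in [z_j]. *)
Definition momentum (j : 'I_n) (t : 'rV[R]_n) : R[i] :=
  - ((2 * pi)%:C * 'i%C * (t ord0 j)%:C).

Lemma phase_sum (t : 'rV[R]_n) h : phase t h = \sum_j h ord0 j * momentum j t.
Proof.
rewrite /phase /cdot mulr_sumr -sumrN; apply: eq_bigr => j _.
by rewrite /momentum; ring.
Qed.

Lemma ccont_momentum j : ccont (momentum j).
Proof.
have -> : momentum j = (fun t => (- ((2 * pi)%:C * 'i%C)) * (t ord0 j)%:C).
  by apply/funext => t; rewrite /momentum mulNr.
apply: ccontM; first exact: ccont_cst.
by apply: ccontR => t; exact: (@coord_continuous _ _ _ ord0 j t).
Qed.

Lemma normc_momentum j (t : 'rV[R]_n) : normc (momentum j t) <= 8 * n%:R * enorm t.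
Proof.
have -> : momentum j t = phase t (delta_mx ord0 j).
  rewrite phase_sum (bigD1 j)//= mxE !eqxx mul1r big1 ?addr0// => i ij.
  by rewrite mxE (negbTE ij) andbF mul0r.
rewrite -[leRHS]mulr1; apply: normc_phase_le => i; rewrite mxE eqxx/=.
by case: (i == j); rewrite ?Normc.normc0 ?Normc.normc1.
Qed.

Variables (f : 'rV[R]_n -> R[i]) (C : R).
Hypothesis cf : ccont f.
Hypothesis fC : forall t,
  normc (f t) <= C * expR (- (16 * n%:R * enorm t)) * row_weight t.

Let absorb (t : 'rV[R]_n) (p : R[i]) (D : R) : 0 <= D ->
  normc p <= D * expR (16 * n%:R * enorm t) ->
  normc (f t * p) <= D * C * row_weight t.
Proof.
move=> D0 pD; rewrite Normc.normcM.
apply: le_trans (ler_pM (normc_ge0 _) (normc_ge0 _) (fC t) pD) _.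
rewrite [leLHS](_ : _ = D * C * row_weight t *
  (expR (- (16 * n%:R * enorm t)) * expR (16 * n%:R * enorm t))); last by ring.
by rewrite -expRD addNr expR0 mulr1.
Qed.

(** First-order expansion in [h] of the Fourier integral of a function with
    exponential decay. Up to a constant the Taylor remainder of the kernel is at
    most [(8 n |t| r)^2 e^(8 n |t| r)], hence at most [r^2 e^(16 n |t|)] since
    [r <= 1], and the decay of [f] absorbs this exponential. *)
Lemma fourier_expansion (h : 'rV[R[i]]_n) (r : R) : 0 <= r <= 1 ->
  (forall j, normc (h ord0 j) <= r) ->
  normc (integral_Rn (fun t => f t * cexp (phase t h)) - integral_Rn f -
    \sum_j h ord0 j * integral_Rn (fun t => f t * momentum j t)) <=
  2 * (16 * r ^+ 2 * C) * W.
Proof.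
move=> /andP[r0 r1] hr.
have T0 (t : 'rV[R]_n) : 0 <= 8 * n%:R * enorm t by rewrite !mulr_ge0// enorm_ge0.
have ph (t : 'rV[R]_n) : normc (phase t h) <= 8 * n%:R * enorm t * r by exact: normc_phase_le.
have ph1 (t : 'rV[R]_n) : normc (phase t h) <= 8 * n%:R * enorm t.
  by rewrite (le_trans (ph t))// ler_piMr.
have T2 (t : 'rV[R]_n) : expR (8 * n%:R * enorm t) <= expR (16 * n%:R * enorm t).
  by rewrite ler_expR; have := T0 t; lra.
pose rem (t : 'rV[R]_n) := f t * (cexp (phase t h) - 1 - phase t h).
have cm j : ccont (fun t => f t * momentum j t).
  by apply: ccontM => //; exact: ccont_momentum.
have crem : ccont rem.
  apply: ccontM => //.
  have -> : (fun t => cexp (phase t h) - 1 - phase t h) =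
      (fun t => cexp (phase t h) + -1 + -1 * phase t h).
    by apply/funext => t; rewrite mulN1r.
  apply: ccontD.
    by apply: ccontD; [exact/ccont_cexp/ccont_phase|exact: ccont_cst].
  by apply: ccontM; [exact: ccont_cst|exact: ccont_phase].
have drem : dominated (16 * r ^+ 2 * C) rem.
  move=> t; apply: absorb; first by rewrite mulr_ge0// sqr_ge0.
  apply: le_trans (cexp_bound _) _.
  (* The square is at most [4 r^2 e^y] with [y := 8 n |t|], and the exponential
     of the Taylor estimate at most [e^y]. *)
  have e1 : normc (phase t h) ^+ 2 <= (8 * n%:R * enorm t * r) ^+ 2.
    by rewrite ler_sqr// ?nnegrE ?normc_ge0// mulr_ge0.
  have e2 := sqr_le_expR (T0 t).
  have e3 : expR (normc (phase t h)) <= expR (8 * n%:R * enorm t) by rewrite ler_expR.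
  have e4 : expR (16 * n%:R * enorm t) =
      expR (8 * n%:R * enorm t) * expR (8 * n%:R * enorm t).
    by rewrite -expRD; congr expR; ring.
  rewrite e4 mulrA; apply: ler_pM => //; first by rewrite mulr_ge0// sqr_ge0.
  apply: le_trans (ler_wpM2l _ e1) _ => //.
  rewrite exprMn.
  have := ler_wpM2r (sqr_ge0 r) e2; lra.
have irem := integrable_Rn_dominated crem drem.
have iif : integrable_Rn f.
  apply: (@integrable_Rn_dominated _ _ (1 * C)) => // t.
  rewrite -[f t]mulr1; apply: absorb => //.
  rewrite Normc.normc1 mul1r -[leLHS]expR0 ler_expR; have := T0 t; lra.
have im j : integrable_Rn (fun t => f t * momentum j t).
  apply: (@integrable_Rn_dominated _ _ (1 * C)) => // t; apply: absorb => //.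
  rewrite mul1r (le_trans (normc_momentum j t))// (le_trans _ (T2 t))//.
  have := expR_ge1Dx (8 * n%:R * enorm t); lra.
have [is1 is2] := integral_Rn_sum (fun j => h ord0 j) im.
have E : (fun t => f t * cexp (phase t h)) = (fun t => 1 * (1 * f t +
    \sum_j h ord0 j * (f t * momentum j t)) + rem t).
  apply/funext => t; rewrite /rem !mul1r.
  have -> : \sum_j h ord0 j * (f t * momentum j t) = f t * phase t h.
    by rewrite phase_sum mulr_sumr; apply: eq_bigr => j _; rewrite mulrCA.
  ring.
rewrite E integral_RnZD//; last exact: integrable_RnZD.
rewrite integral_RnZD// is2 !mul1r.
rewrite (_ : _ - _ - _ = integral_Rn rem); last by ring.
exact: integral_Rn_bound.
Qed.

End z_derivative.

Section DS_entire.
Context {R : realType} {n : nat}.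

Lemma coord_le_norm (K : numFieldType) m (h : 'rV[K]_m) j : `|h ord0 j| <= `|h|.
Proof.
rewrite [leRHS]mx_normE -[leLHS]nngE num_le.
exact: (le_bigmax _ (fun ij => `|h ij.1 ij.2|%:nng) (ord0, j)).
Qed.

Lemma tube_exists (z : 'rV[R[i]]_n) : exists k, tube k z.
Proof.
exists (Num.truncn (\sum_i `|cIm (z ord0 i)|)).+1 => i.
apply: le_trans (ltW (truncnS_gt _)).
by rewrite (bigD1 i)//= lerDl sumr_ge0.
Qed.

(** The kernel at [z + h] is the kernel at [z] times [e^(- 2 pi i t.h)], so that
    the integrand at [z] plays the role of [f] in the expansion above. *)
Lemma zentire_DS (u : 'rV[R]_n) (phi : 'rV[R]_n -> R[i]) g :
  enorm u = 1 -> ccont phi -> ccont g ->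
  (forall N, exists A, rapid N A phi) -> (forall N, exists B, rapid N B g) ->
  zentire (DS u phi g).
Proof.
move=> u1 cphi cg rphi' rg' x z.
have [k kz] := tube_exists z.
(* The 16 leaves the decay [e^(- 16 n |t|)] that the Taylor remainder needs. *)
pose N := (k + (9 * k + 16 + 1) * n)%N.
have kN : (k <= N)%N by rewrite leq_addr.
have mN : ((9 * k + 16 + 1) * n <= N)%N by rewrite leq_addl.
have [A rphi] := rphi' N; have [B rg] := rg' N.
have A0 := rapid_ge0 rphi; have B0 := rapid_ge0 rg.
pose f := DS_integrand u phi g x z.
have fC t : normc (f t) <= (A * B) * expR (- (16 * n%:R * enorm t)) * row_weight t.
  have := DS_integrand_bound x t u1 kz kN mN rphi rg; apply: le_trans.
  by rewrite ler_peMl ?normc_ge0// -expR0 ler_expR mulr_ge0.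
have cf : ccont f by exact: ccont_DS_integrand.
have DSE h : DS u phi g x (z + h) = integral_Rn (fun t => f t * cexp (phase t h)).
  congr integral_Rn; apply/funext => t.
  by rewrite /f !DS_integrandE phaseD cexpD mulrA.
apply: (@differentiable_quadratic _ _ (DS u phi g x : 'rV[R[i]]_n -> R[i]^o) z
  (fun j => integral_Rn (fun t => f t * momentum j t))
  (2 * (16 * (A * B)) * @total_weight R n)%:C).
  by rewrite lecR !mulr_ge0// total_weight_ge0.
move=> h h1.
have [r hr] : exists r : R, `|h| = r%:C.
  by exists (cRe `|h|); apply/esym/RRe_real/ger0_real.
have r01 : 0 <= r <= 1 by rewrite -!lecR -hr normr_ge0.
have hj j : normc (h ord0 j) <= r by rewrite -lecR -hr; exact: coord_le_norm.
have := fourier_expansion cf fC r01 hj.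
rewrite DSE hr -rmorphXn -rmorphM/= => H.
have nE (w : R[i]) : `|w| = (normc w)%:C by [].
rewrite nE lecR; apply: le_trans H _.
by rewrite le_eqVlt; apply/orP; left; apply/eqP; ring.
Qed.

End DS_entire.

(** * Elements of K_1 and the seminorm estimate *)

Section pure_derivatives.
Context {R : realType} {m : nat}.
Implicit Types f : 'rV[R]_m -> R[i].

Definition pure_deriv (j : 'I_m) (a : nat) f (t : 'rV[R]_m) : R[i] :=
  pderivs (nseq a j) (fun t => cRe (f t)) t +i*
  pderivs (nseq a j) (fun t => cIm (f t)) t.

Lemma multi_seq_single (j : 'I_m) a :
  multi_seq (fun i => if i == j then a else 0%N) = nseq a j.
Proof.
rewrite /multi_seq; have := enum_uniq 'I_m; have := mem_enum 'I_m j.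
rewrite inE; elim: (enum 'I_m) => // i s IH; rewrite inE eq_sym /=.
have [->|ij] /= := eqVneq i j; last by move=> js /andP[_ us]; rewrite IH.
move=> _ /andP[js _]; rewrite -[RHS]cats0; congr (_ ++ _).
elim: s js {IH} => // l s IH; rewrite inE negb_or eq_sym => /andP[lj js] /=.
by rewrite (negbTE lj) IH.
Qed.

Lemma pure_deriv0 j f : pure_deriv j 0 f = f.
Proof. by apply/funext => t; rewrite /pure_deriv/=; case: (f t). Qed.

Lemma ccont_pure_deriv j a f : csmooth f -> ccont (pure_deriv j a f).
Proof. by move=> [sr si]; split; exact: smooth_continuous. Qed.

Lemma is_derive_line (h : 'rV[R]_m -> R) (t v : 'rV[R]_m) (y : R) :
  derivable h (t + y *: v) v ->
  is_derive y 1 (fun s => h (t + s *: v)) ('D_v h (t + y *: v)).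
Proof.
move=> dh.
have E : (fun r : R => r^-1 *: (h (t + (r *: (1 : R) + y) *: v) - h (t + y *: v))) =
    (fun r : R => r^-1 *: (h (r *: v + (t + y *: v)) - h (t + y *: v))).
  apply/funext => r; congr (_ *: (h _ - _)).
  by rewrite -[r *: 1]/(r * 1) mulr1 scalerDl addrCA.
split; first by rewrite /derivable/= E.
by rewrite /derive/= E.
Qed.

Lemma is_cderive_pure_deriv j a f t (y : R) : csmooth f ->
  is_cderive (fun y => pure_deriv j a f (t + y *: delta_mx ord0 j)) y
    (pure_deriv j a.+1 f (t + y *: delta_mx ord0 j)).
Proof.
by move=> [sr si]; split; apply: is_derive_line; exact: smooth_derivable.
Qed.

(** A seminorm of order [N] controls all derivatives of order at most [N] with
    the weight [e^(N|t|)]. *)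
Lemma rapid_pure_deriv j a f (N : nat) (A : R) : (a <= N)%N ->
  (K1_seminorm N f <= A%:E)%E -> rapid N A (pure_deriv j a f).
Proof.
move=> aN fA t; rewrite expRN ler_pdivlMr ?expR_gt0// mulrC -lee_fin.
apply: le_trans fA.
pose al : 'I_m -> nat := fun i => if i == j then a else 0%N.
apply: (@ereal_sup_ubound _ _ _); exists (al, t) => /=.
  by rewrite /al -big_mkcond big_pred1_eq.
by rewrite /cpderiv/= /al multi_seq_single.
Qed.

End pure_derivatives.

Section transform.
Context {R : realType} {n : nat}.
Variable u : 'rV[R]_n.
Hypothesis u1 : enorm u = 1.
Implicit Types (phi : K1 R n) (g : K1 R 1).

Lemma K1_csmooth m (f : K1 R m) : csmooth f.
Proof. by have /asboolP[] := K1_funP f. Qed.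

Lemma K1_ccont m (f : K1 R m) : ccont f.
Proof.
have [sr si] := K1_csmooth f; split.
  exact: (smooth_continuous sr [::]).
exact: (smooth_continuous si [::]).
Qed.

Lemma K1_norm_fin m N (f : K1 R m) : exists2 A : R, 0 <= A & (K1_norm N f <= A%:E)%E.
Proof.
have /asboolP[_ /(_ N)/fsup_lty[M fM]] := K1_funP f.
exists `|M| => //; apply: ge_ereal_sup => _ [p Dp <-].
by rewrite lee_fin (le_trans (fM _ Dp)) ?ler_norm.
Qed.

Lemma K1_rapid m N (f : K1 R m) (A : R) : (K1_norm N f <= A%:E)%E -> rapid N A f.
Proof.
(* In dimension 0 there is no coordinate along which to take derivatives. *)
case: m f => [|m] f fA; last first.
  by have := @rapid_pure_deriv _ _ ord0 0 f N A (leq0n N) fA; rewrite pure_deriv0.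
move=> t; rewrite expRN ler_pdivlMr ?expR_gt0// mulrC -lee_fin.
apply: le_trans fA; apply: (@ereal_sup_ubound _ _ _).
exists ((fun=> 0%N), t) => /=; first by rewrite big_ord0.
rewrite /cpderiv/= /multi_seq (_ : enum 'I_0 = [::]); last first.
  by apply: size0nil; rewrite size_enum_ord.
by rewrite /=; case: (K1_fun f t).
Qed.

Lemma K1_rapid_exists m (f : K1 R m) N : exists A, rapid N A f.
Proof. by have [A _ /K1_rapid] := K1_norm_fin N f; exists A. Qed.

(** The sign [(-1)^p] makes the [p]-th derivative of the transform in [x] equal to
    the transform with [g] replaced by this function. *)
Definition signed_deriv g (p : nat) (v : 'rV[R]_1) : R[i] :=
  (-1) ^+ p * pure_deriv ord0 p g v.

Lemma signed_deriv0 g : signed_deriv g 0 = g.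
Proof. by apply/funext => v; rewrite /signed_deriv expr0 mul1r pure_deriv0. Qed.

Lemma ccont_signed_deriv g p : ccont (signed_deriv g p).
Proof.
apply: ccontM; first exact: ccont_cst.
exact/ccont_pure_deriv/K1_csmooth.
Qed.

Lemma const_mx_line (s : R) : const_mx s = 0 + s *: delta_mx ord0 ord0 :> 'rV[R]_1.
Proof. by apply/rowP => i; rewrite !mxE !ord1 !eqxx mulr1 add0r. Qed.

Lemma is_cderive_signed_deriv g p (s : R) :
  is_cderive (fun s => signed_deriv g p (const_mx s)) s (- signed_deriv g p.+1 (const_mx s)).
Proof.
under eq_fun do rewrite const_mx_line; rewrite const_mx_line.
have := is_cderiveM (is_cderive_cst ((-1) ^+ p) s)
  (is_cderive_pure_deriv ord0 p 0 s (K1_csmooth g)).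
move/is_cderive_eq; apply.
by rewrite /signed_deriv mul0r add0r exprS mulN1r mulNr opprK.
Qed.

Lemma normc_sign p : normc ((-1) ^+ p : R[i]) = 1.
Proof.
elim: p => [|p IH]; first by rewrite expr0 Normc.normc1.
by rewrite exprS Normc.normcM IH normcN Normc.normc1 mulr1.
Qed.

Lemma rapid_signed_deriv g N p (B : R) : (p <= N)%N -> (K1_norm N g <= B%:E)%E ->
  rapid N B (signed_deriv g p).
Proof.
move=> pN gB t; rewrite /signed_deriv Normc.normcM normc_sign mul1r.
exact: rapid_pure_deriv.
Qed.

Lemma integrable_DS_integrand phi g x z : integrable_Rn (DS_integrand u phi g x z).
Proof.
have [k kz] := tube_exists z.
pose N := (k + (9 * k + 1) * n)%N.
have kN : (k <= N)%N by rewrite leq_addr.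
have mN : ((9 * k + 1) * n <= N)%N by rewrite leq_addl.
have [A rphi] := K1_rapid_exists phi N; have [B rg] := K1_rapid_exists g N.
apply: integrable_Rn_dominated; first by apply: ccont_DS_integrand; exact: K1_ccont.
exact: (DS_integrand_dominated x u1 kz kN mN rphi rg).
Qed.

Lemma DS_signed_cderive phi g p x z :
  is_cderive (fun x => DS u phi (signed_deriv g p) x z) x
    (DS u phi (signed_deriv g p.+1) x z).
Proof.
have [k kz] := tube_exists z.
pose N := (k + (9 * k + 1) * n + p.+1)%N.
have kN : (k <= N)%N by rewrite /N -addnA leq_addr.
have mN : ((9 * k + 1) * n <= N)%N by rewrite /N addnAC leq_addl.
have pN : (p.+1 <= N)%N by rewrite leq_addl.
have [A A0 phiA] := K1_norm_fin N phi; have [B B0 gB] := K1_norm_fin N g.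
apply: (DS_cderive u1 kz kN mN (K1_ccont phi) (ccont_signed_deriv g p)
  (K1_rapid phiA) (rapid_signed_deriv (ltnW pN) gB) (rapid_signed_deriv pN gB)).
exact: is_cderive_signed_deriv.
Qed.

Lemma derive1n_DS phi g l z :
  derive1n l (fun x => cRe (DS u phi g x z)) =
    (fun x => cRe (DS u phi (signed_deriv g l) x z)) /\
  derive1n l (fun x => cIm (DS u phi g x z)) =
    (fun x => cIm (DS u phi (signed_deriv g l) x z)).
Proof.
elim: l => [|l [IHr IHi]]; first by rewrite signed_deriv0.
rewrite !derive1nS IHr IHi; split; apply/funext => x;
  have [dr di] := DS_signed_cderive phi g l x z; rewrite derive1E; exact: derive_val.
Qed.

Lemma xsmooth_DS phi g : xsmooth (DS u phi g).
Proof.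
move=> z; split; split => l x; have [Er Ei] := derive1n_DS phi g l z;
  have [dr di] := DS_signed_cderive phi g l x z.
  by rewrite Er; case: dr.
by rewrite Ei; case: di.
Qed.

Lemma xderiv_DS phi g l x z :
  xderiv l (DS u phi g) x z = DS u phi (signed_deriv g l) x z.
Proof.
by rewrite /xderiv; have [-> ->] := derive1n_DS phi g l z; case: (DS _ _ _ _ _).
Qed.

Lemma cenorm_le (z : 'rV[R[i]]_n) (M : R) : 0 <= M ->
  (forall i, normc (z ord0 i) <= M) -> cenorm z <= n%:R * M.
Proof.
move=> M0 zM; rewrite /cenorm -[leRHS]ger0_norm ?mulr_ge0// -sqrtr_sqr ler_wsqrtr//.
apply: (@le_trans _ _ (\sum_(i < n) M ^+ 2)).
  by apply: ler_sum => i _; rewrite ler_sqr ?nnegrE ?normc_ge0.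
rewrite sumr_const card_ord -[leLHS]mulr_natl exprMn ler_wpM2r ?sqr_ge0//.
by rewrite expr2 -natrM ler_nat; case: (n) => // k; rewrite leq_pmulr.
Qed.

(** With [M] the larger of 1 and the largest [|z_j|], the weight in [z] reduces to
    a power of a single coordinate, which is what integration by parts in one
    direction controls. *)
Lemma poly_weight_le (k : nat) (z : 'rV[R[i]]_n) (M : R) : 1 <= M ->
  (forall i, normc (z ord0 i) <= M) ->
  (1 + cenorm z ^+ 2) `^ (k%:R / 2) <= n.+1%:R ^+ k * M ^+ k.
Proof.
move=> M1 zM; have M0 : 0 <= M by rewrite (le_trans _ M1).
have c0 : 0 <= cenorm z := sqrtr_ge0 _.
have c1 : 0 <= 1 + cenorm z ^+ 2 by rewrite addr_ge0 ?sqr_ge0.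
rewrite mulrC powRrM powR12_sqrt// powR_mulrn ?sqrtr_ge0//.
rewrite -exprMn lerXn2r ?nnegrE ?sqrtr_ge0 ?mulr_ge0//.
rewrite -[leRHS]ger0_norm ?mulr_ge0// -sqrtr_sqr ler_wsqrtr//.
apply: (@le_trans _ _ ((1 + cenorm z) ^+ 2)).
  by rewrite sqrrD expr1n lerD2r lerDl mul1r mulrn_wge0.
rewrite ler_sqr ?nnegrE ?mulr_ge0 ?addr_ge0// -natr1 mulrDl mul1r addrC.
by rewrite lerD// cenorm_le.
Qed.

(** Order of the seminorms of [phi] and [g] that control the seminorm [(k, l)] of
    the transform: [k + l] derivatives are used, and the rest pays for the
    exponential growth of the weight in [x] and of the kernel in the tube. *)
Definition bound_order (kl : nat * nat) : nat :=
  kl.1 + kl.2 + (9 * kl.1 + 1) * n.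

Definition bound_const (kl : nat * nat) : R :=
  n.+1%:R ^+ kl.1 * 2 ^+ kl.1 * 2 * @total_weight R n.

Lemma bound_const_ge0 kl : 0 <= bound_const kl.
Proof. by rewrite /bound_const !mulr_ge0// ?exprn_ge0// total_weight_ge0. Qed.

(** The estimate from which continuity follows: if the largest coordinate of [z]
    is at most 1 the bound on the integrand suffices, otherwise [k] integrations
    by parts in the direction of that coordinate give the factor [|z_j|^k]. *)
Lemma KU_seminorm_DS phi g kl (A B : R) : (0 < n)%N ->
  (K1_norm (bound_order kl) phi <= A%:E)%E ->
  (K1_norm (bound_order kl) g <= B%:E)%E ->
  (KU_seminorm kl (DS u phi g) <= (bound_const kl * (A * B))%:E)%E.
Proof.
case: kl => k l n0; set N := bound_order _ => phiA gB.
have A0 := rapid_ge0 (K1_rapid phiA); have B0 := rapid_ge0 (K1_rapid gB).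
apply: ge_ereal_sup => _ [[x z] kz <-]; rewrite lee_fin.
suff : expR (k%:R * `|x|) * (1 + cenorm z ^+ 2) `^ (k%:R / 2) *
    normc (xderiv l (DS u phi g) x z) <= bound_const (k, l) * (A * B) by [].
rewrite xderiv_DS; have {}kz : tube k z := kz.
have kN : (k <= N)%N by rewrite /N /bound_order/= -addnA leq_addr.
have mN : ((9 * k + 1) * n <= N)%N by rewrite /N /bound_order leq_addl.
have klN : (l + k <= N)%N by rewrite /N /bound_order/= addnC leq_addr.
pose W := @total_weight R n; have W0 : 0 <= W := total_weight_ge0.
set E := expR (k%:R * `|x|); have E0 : 0 < E := expR_gt0 _.
pose i0 := Ordinal n0.
pose j := [arg max_(i > i0) normc (z ord0 i)]%O.
have zj i : normc (z ord0 i) <= normc (z ord0 j).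
  by rewrite /j; case: arg_maxP => //= r _ /(_ i); exact.
have decay m : (m <= k)%N ->
    normc (z ord0 j) ^+ m * (E * normc (DS u phi (signed_deriv g l) x z)) <=
    2 ^+ k * (2 * (A * B) * W).
  move=> mk.
  have := @DS_decay R n u u1 N k A B z x j (fun p => pure_deriv j p phi)
    (signed_deriv g) m 0 l kz kN mN.
  rewrite pure_deriv0 => /(_ _ _ _ _ _ _) h.
  rewrite mulrCA -ler_pdivlMl//; apply: le_trans (h _ _ _ _ _ _) _.
  - by move=> p; exact/ccont_pure_deriv/K1_csmooth.
  - by move=> p; exact: ccont_signed_deriv.
  - by move=> p t y; exact/is_cderive_pure_deriv/K1_csmooth.
  - by move=> p s; exact: is_cderive_signed_deriv.
  - move=> p pm; apply: rapid_pure_deriv => //.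
    by rewrite (leq_trans pm)// (leq_trans mk).
  - move=> p pm; apply: rapid_signed_deriv => //.
    by rewrite (leq_trans pm)// (leq_trans _ klN)// leq_add2l.
  rewrite expRN -/E -/W [leLHS](_ : _ =
    E^-1 * (2 ^+ m * (2 * (A * B) * W))); last by ring.
  rewrite ler_wpM2l ?invr_ge0 ?(ltW E0)// ler_wpM2r ?mulr_ge0//.
  by rewrite ler_weXn2l// ler1n.
set D := normc (DS u phi (signed_deriv g l) x z) in decay *.
have conclude M : 1 <= M -> (forall i, normc (z ord0 i) <= M) ->
    M ^+ k * (E * D) <= 2 ^+ k * (2 * (A * B) * W) ->
    E * (1 + cenorm z ^+ 2) `^ (k%:R / 2) * D <= bound_const (k, l) * (A * B).
  move=> M1 zM MD; rewrite mulrAC mulrC.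
  apply: le_trans (ler_wpM2r _ (poly_weight_le k M1 zM)) _.
    by rewrite mulr_ge0 ?normc_ge0// ltW.
  rewrite -mulrA; apply: le_trans (ler_wpM2l _ MD) _; first exact: exprn_ge0.
  by rewrite le_eqVlt; apply/orP; left; apply/eqP; rewrite /bound_const -/W/=; ring.
have [z1|z1] := leP (normc (z ord0 j)) 1.
  apply: (conclude 1 (lexx 1)); first by move=> i; exact: le_trans (zj i) z1.
  by have := decay 0%N isT; rewrite expr1n expr0.
by apply: (conclude _ (ltW z1) zj); exact: decay.
Qed.

End transform.

(** * Continuity of the sesquilinear mapping *)

Section continuity.
Context {R : realType} {n : nat}.
Variable u : 'rV[R]_n.
Hypotheses (n0 : (0 < n)%N) (u1 : enorm u = 1).
Implicit Types (phi psi : K1 R n) (g h : K1 R 1).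

Lemma is_KU_DS phi g : DS u phi g \in KU_pred.
Proof.
apply/asboolP; split; first exact: xsmooth_DS.
  by apply: zentire_DS => //; [exact: K1_ccont|exact: K1_ccont
    |exact: K1_rapid_exists|exact: K1_rapid_exists].
move=> kl.
have [A A0 phiA] := K1_norm_fin (@bound_order n kl) phi.
have [B B0 gB] := K1_norm_fin (@bound_order n kl) g.
by apply: le_lt_trans (KU_seminorm_DS u1 n0 phiA gB) _; exact: ltry.
Qed.

Definition DS_KU phi g : KU R n := MkKU (is_KU_DS phi g).

Lemma KU_ext (F G : KU R n) : (forall x z, F x z = G x z) -> F = G.
Proof. by move=> FG; apply: val_inj; apply/funext => x; apply/funext => z; exact: FG. Qed.

Lemma DS_KU_linear a phi psi g :
  DS_KU (a *: phi + psi) g = a *: DS_KU phi g + DS_KU psi g.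
Proof.
apply: KU_ext => x z.
transitivity (a * DS u phi g x z + DS u psi g x z); last by [].
rewrite -integral_RnZD; [|exact: integrable_DS_integrand..].
congr integral_Rn; apply/funext => t.
rewrite !DS_integrandE.
have -> : (a *: phi + psi : K1 R n) t = a * phi t + psi t by [].
ring.
Qed.

Lemma DS_KU_antilinear a phi g h :
  DS_KU phi (a *: g + h) = conjc a *: DS_KU phi g + DS_KU phi h.
Proof.
apply: KU_ext => x z.
transitivity (conjc a * DS u phi g x z + DS u phi h x z); last by [].
rewrite -integral_RnZD; [|exact: integrable_DS_integrand..].
congr integral_Rn; apply/funext => t.
rewrite !DS_integrandE.
set s := const_mx _.
have -> : (a *: g + h : K1 R 1) s = a * g s + h s by [].
rewrite rmorphD rmorphM; ring.
Qed.

(** A sesquilinear mapping varies by a quadratic term and two linear ones, which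
    reduces joint continuity to the seminorm estimate. *)
Lemma DS_KU_sub phi psi g h : DS_KU phi g - DS_KU psi h =
  DS_KU (phi - psi) (g - h) + DS_KU (phi - psi) h + DS_KU psi (g - h).
Proof.
have Bl p q f : DS_KU (p - q) f = DS_KU p f - DS_KU q f.
  by rewrite addrC -scaleN1r DS_KU_linear scaleN1r addrC.
have Br p f q : DS_KU p (f - q) = DS_KU p f - DS_KU p q.
  rewrite addrC -scaleN1r DS_KU_antilinear rmorphN1 scaleN1r addrC//.
have collapse (V : zmodType) (a b c d : V) : a - d = a - c - (b - d) + (c - d) + (b - d).
  by rewrite addrAC subrK addrA subrK.
rewrite !Bl !Br; exact: collapse.
Qed.

Lemma KU_norm_DS phi g kl (A B : R) :
  (K1_norm (@bound_order n kl) phi <= A%:E)%E ->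
  (K1_norm (@bound_order n kl) g <= B%:E)%E ->
  (KU_norm kl (DS_KU phi g) <= (@bound_const R n kl * (A * B))%:E)%E.
Proof. exact: KU_seminorm_DS. Qed.

Lemma DS_KU_near phi0 g0 kl (e : R) : 0 < e ->
  \forall p \near (phi0, g0), (KU_norm kl (DS_KU p.1 p.2 - DS_KU phi0 g0)%R < e%:E)%E.
Proof.
move=> e0; set N := @bound_order n kl; set C := @bound_const R n kl.
have C0 : 0 <= C := bound_const_ge0 kl.
have [A A0 phiA] := K1_norm_fin N phi0; have [B B0 gB] := K1_norm_fin N g0.
(* For [d <= 1] the three terms of [DS_KU_sub] add up to at most
   [C d (1 + A + B)]; the added 1 makes the denominator positive. *)
pose S := C * (1 + A + B) + 1.
have S0 : 0 < S by rewrite ltr_wpDl// mulr_ge0// !addr_ge0.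
pose d := Num.min 1 (e / S).
have d0 : 0 < d by rewrite lt_min ltr01 divr_gt0.
have d1 : d <= 1 by rewrite ge_min lexx.
have dS : d * S <= e by rewrite -ler_pdivlMr// ge_min lexx orbT.
exists ([set p | (K1_norm N (p - phi0)%R < d%:E)%E],
  [set q | (K1_norm N (q - g0)%R < d%:E)%E]).
  by split => /=; exists [:: N], d; split => // p /(_ N); apply; rewrite inE.
move=> [p q] [/= /ltW pd /ltW qd].
rewrite DS_KU_sub; apply: le_lt_trans (KU_normD _ _ _) _.
apply: (@le_lt_trans _ _ ((C * (d * d))%:E + (C * (d * B))%:E + (C * (A * d))%:E)%E).
  apply: leeD; last exact: KU_norm_DS.
  apply: le_trans (KU_normD _ _ _) _; apply: leeD; exact: KU_norm_DS.
rewrite -!EFinD lte_fin; apply: lt_le_trans dS.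
have : C * d * d <= C * d * 1 by rewrite ler_wpM2l// mulr_ge0// ltW.
rewrite /S; lra.
Qed.

Lemma continuous_DS_KU : continuous (fun p : K1 R n * K1 R 1 => DS_KU p.1 p.2).
Proof.
move=> [phi0 g0] U [s [e [e0 sU]]].
suff : \forall p \near (phi0, g0), forall i, i \in s ->
    (KU_norm i (DS_KU p.1 p.2 - DS_KU phi0 g0)%R < e%:E)%E.
  by apply: filterS => p ps; apply: sU => i; exact: ps.
elim: s {sU} => [|kl s IH].
  by apply: (@filterE _ (nbhs (phi0, g0))) => p i; rewrite in_nil.
apply: (@filterS _ (nbhs (phi0, g0)) _ _ _ _
  (filterI (DS_KU_near phi0 g0 kl e0) IH)) => p [pk ps] i.
by rewrite inE => /orP[/eqP ->//|]; exact: ps.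
Qed.

End continuity.

Unset Implicit Arguments.

Theorem theorem3p1 (R : realType) (n : nat) (u : 'rV[R]_n)
    (n_ge1 : (1 <= n)%N) (u_sphere : enorm u = 1) :
  exists DSu : K1 R n -> K1 R 1 -> KU R n,
    [/\ forall (phi : K1 R n) (g : K1 R 1) (x : R) (z : 'rV[R[i]]_n),
          integrable_Rn (DS_integrand u phi g x z),
        forall (phi : K1 R n) (g : K1 R 1) (x : R) (z : 'rV[R[i]]_n),
          DSu phi g x z = DS u phi g x z,
        forall (a : R[i]) (phi psi : K1 R n) (g : K1 R 1),
          DSu (a *: phi + psi) g = a *: DSu phi g + DSu psi g,
        forall (a : R[i]) (phi : K1 R n) (g h : K1 R 1),
          DSu phi (a *: g + h) = conjc a *: DSu phi g + DSu phi h &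
        continuous (fun p : K1 R n * K1 R 1 => DSu p.1 p.2)].
Proof.
exists (DS_KU n_ge1 u_sphere); split.
- exact: integrable_DS_integrand.
- by [].
- exact: DS_KU_linear.
- exact: DS_KU_antilinear.
- exact: continuous_DS_KU.
Qed.
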